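(* Let $H$ be a non-factorizable semi-norming $k$-hypergraph pair with $|H|\ge2$. (i) If $H$ is of Type II, or of Type I with parameter $s\ge2$, then $\ell_H$ is $2$-uniformly smooth and $|H|$-uniformly convex. (ii) If $H$ is of Type I with parameter $1<s\le2$, then $\ell_H$ is $s$-uniformly smooth and $|H|$-uniformly convex.
   Context: A $k$-hypergraph pair $H=(\alpha,\beta)$ consists of finite nonempty sets $V_1,\dots,V_k$ and functions $\alpha,\beta:V\to\mathbb{R}$, where $V=V_1\times\cdots\times V_k$; its size is $|H|=\sum_{\omega\in V}(|\alpha(\omega)|+|\beta(\omega)|)$. All measures are positive. For a measure space $\mathcal M=(\Omega,\mathcal F,\mu)$, the space $\Omega^{V_1}\times\cdots\times\Omega^{V_k}$ (points $x=(x_{i,v})_{i\in[k],v\in V_i}$) carries the product measure, and each $\omega=(\omega_1,\dots,\omega_k)\in V$ defines the projection $\omega(x)=(x_{1,\omega_1},\dots,x_{k,\omega_k})\in\Omega^k$. For measurable $f:\Omega^k\to\mathbb C$, $f^H(x)=\prod_{\omega\in V} f(\omega(x))^{\alpha(\omega)}\,\overline{f(\omega(x))^{\beta(\omega)}}$, with the convention $0^0=1$ (non-integer complex powers taken with a fixed branch). When $\alpha,\beta\ge 0$, set $\|f\|_H=(\int f^H)^{1/|H|}$, and let $L_H(\mathcal M)$ be the set of measurable $f$ with $\|\,|f|\,\|_H<\infty$. $H$ (with $\alpha,\beta\ge0$) is called norming (resp. semi-norming) if $\|\cdot\|_H$ is a norm (resp. semi-norm) on $L_H(\mathcal M)$ for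 every measure space $\mathcal M$. $\ell_H:=L_H(\mathbb N)$ with counting measure on $\mathbb N$. $H$ is non-factorizable if it is not isomorphic to a disjoint union of two hypergraph pairs (the disjoint union places two pairs on disjoint copies of the coordinate sets, zero elsewhere). $H$ is of Type I with parameter $s$ if $s\ge1$ and $\alpha(\psi)=\beta(\psi)=s/2$ for every $\psi\in{\rm supp}(\alpha)\cup{\rm supp}(\beta)$; $H$ is of Type II if $\{\alpha(\psi),\beta(\psi)\}=\{0,1\}$ for every $\psi\in{\rm supp}(\alpha)\cup{\rm supp}(\beta)$. For a (semi-)normed space $X$: modulus of smoothness $\rho_X(\tau)=\sup\{\frac{\|x-\tau y\|+\|x+\tau y\|}{2}-1:\|x\|=\|y\|=1\}$; modulus of convexity $\delta_X(\epsilon)=\inf\{1-\|\frac{x+y}{2}\|:\|x\|=\|y\|=1,\|x-y\|\ge2\epsilon\}$ for $0\le\epsilon\le1$. For $t\in(1,2]$, $X$ is $t$-uniformly smooth if $\rho_X(\tau)\le(C\tau)^t$ for some constant $C>0$ and all $\tau>0$; for $r\in[2,\infty)$, $X$ is $r$-uniformly convex if $\delta_X(\epsilon)\ge(\epsilon/C)^r$ for some constant $C>0$. *)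

(* Defs.v *)
From HB Require Import structures.
From mathcomp Require Import all_boot all_order all_algebra.
From mathcomp Require Import all_classical all_reals all_analysis.
From mathcomp Require Import complex.
Set Implicit Arguments. Unset Strict Implicit. Unset Printing Implicit Defensive.
Import Order.TTheory GRing.Theory Num.Theory.
Local Open Scope ring_scope.
Local Open Scope classical_set_scope.

(* Hypergraph pairs.  A k-hypergraph pair is given by sizes n : 'I_k -> nat  *)
(* (the finite nonempty sets are V_i = 'I_(n i).+1), and                    *)
(* alpha, beta : V -> R where V = V_1 x ... x V_k.                          *)
Notation Vt k n := {dffun forall i : 'I_k, 'I_(n i).+1}.
(* the disjoint union of the V_i : indices of the coordinates x_{i,v} *)
Notation Jt k n := {i : 'I_k & 'I_(n i).+1}.

Section HypergraphPairs.
Context {R : realType} {k : nat}.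

Definition hsize (n : 'I_k -> nat) (alpha beta : Vt k n -> R) : R :=
  \sum_(w : Vt k n) (`|alpha w| + `|beta w|).

Definition hiso (n n' : 'I_k -> nat) (alpha beta : Vt k n -> R)
    (alpha' beta' : Vt k n' -> R) : Prop :=
  exists sigma : forall i : 'I_k, 'I_(n i).+1 -> 'I_(n' i).+1,
    (forall i, bijective (sigma i)) /\
    forall w : Vt k n,
      alpha' (finfun (fun i => sigma i (w i)) : Vt k n') = alpha w /\
      beta' (finfun (fun i => sigma i (w i)) : Vt k n') = beta w.

(* disjoint union: the coordinate set V_i^1 = 'I_(n1 i).+1 is placed as the  *)
(* first (n1 i).+1 elements of 'I_((n1 i).+1 + n2 i).+1, and                 *)
(* V_i^2 = 'I_(n2 i).+1 as the remaining ones; the weight is 0 on "mixed"   *)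
(* tuples.                                                                   *)
Definition dunion_size (n1 n2 : 'I_k -> nat) : 'I_k -> nat :=
  fun i => ((n1 i).+1 + n2 i)%N.

Definition dunion_fun (n1 n2 : 'I_k -> nat) (a1 : Vt k n1 -> R)
    (a2 : Vt k n2 -> R) (w : Vt k (dunion_size n1 n2)) : R :=
  if [forall i, (w i < (n1 i).+1)%N] then
    a1 (finfun (fun i => (inord (w i) : 'I_(n1 i).+1)))
  else if [forall i, ((n1 i).+1 <= w i)%N] then
    a2 (finfun (fun i => (inord (w i - (n1 i).+1) : 'I_(n2 i).+1)))
  else 0.

Definition factorizable (n : 'I_k -> nat) (alpha beta : Vt k n -> R) : Prop :=
  exists (n1 n2 : 'I_k -> nat) (a1 b1 : Vt k n1 -> R) (a2 b2 : Vt k n2 -> R),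
    hiso alpha beta (dunion_fun a1 a2) (dunion_fun b1 b2).

Definition non_factorizable (n : 'I_k -> nat) (alpha beta : Vt k n -> R) :=
  ~ factorizable alpha beta.

Definition supp_ab (n : 'I_k -> nat) (alpha beta : Vt k n -> R) (w : Vt k n) :=
  alpha w != 0 \/ beta w != 0.

Definition typeI (n : 'I_k -> nat) (alpha beta : Vt k n -> R) (s : R) : Prop :=
  1 <= s /\ forall w, supp_ab alpha beta w -> alpha w = s / 2 /\ beta w = s / 2.

Definition typeII (n : 'I_k -> nat) (alpha beta : Vt k n -> R) : Prop :=
  forall w, supp_ab alpha beta w ->
    (alpha w = 0 /\ beta w = 1) \/ (alpha w = 1 /\ beta w = 0).

End HypergraphPairs.

(* Complex numbers: modulus, principal argument in (-pi, pi], and the power *)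
(* z ^ a with this fixed branch, with 0 ^ 0 = 1 (and 0 ^ a = 0, a <> 0).    *)
Section ComplexPow.
Context {R : realType}.
Local Open Scope complex_scope.

Definition cmod (z : R[i]) : R := Num.sqrt (complex.Re z ^+ 2 + complex.Im z ^+ 2).

Definition carg (z : R[i]) : R :=
  if 0 <= complex.Im z then acos (complex.Re z / cmod z) else - acos (complex.Re z / cmod z).

Definition cpow (z : R[i]) (a : R) : R[i] :=
  if z == 0 then (if a == 0 then 1 else 0)
  else (powR (cmod z) a * cos (a * carg z)) +i* (powR (cmod z) a * sin (a * carg z)).

End ComplexPow.

(* Integration over Omega^{V_1} x ... x Omega^{V_k} = Omega^J (product       *)
(* measure), realised as the iterated integral over the coordinates (equal  *)
(* to the product-measure integral by Tonelli, mu being sigma-finite).      *)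
Section Integration.
Context {R : realType} {d : measure_display} {T : measurableType d}.
Variable mu : {measure set T -> \bar R}.
Context {J : finType}.

Definition upd (x : J -> T) (j : J) (y : T) : J -> T :=
  fun j' => if j' == j then y else x j'.

Fixpoint iint_seq (s : seq J) (g : (J -> T) -> \bar R) (x : J -> T) : \bar R :=
  match s with
  | [::] => g x
  | j :: s' => (\int[mu]_(y in setT) iint_seq s' g (upd x j y))%E
  end.

Definition iint (g : (J -> T) -> \bar R) : \bar R :=
  iint_seq (enum J) g (fun _ => point).

Definition rint (g : (J -> T) -> R) : R :=
  fine (iint (fun x => (Num.max (g x) 0)%:E)) -
  fine (iint (fun x => (Num.max (- g x) 0)%:E)).

Definition cint (g : (J -> T) -> R[i]) : R[i] :=
  (rint (fun x => complex.Re (g x)) +i* rint (fun x => complex.Im (g x)))%C.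

End Integration.

Section HomDensity.
Context {R : realType} {k : nat} {n : 'I_k -> nat}.
Variables alpha beta : Vt k n -> R.

Definition hproj {T : Type} (w : Vt k n) (x : Jt k n -> T) : k.-tuple T :=
  [tuple x (Tagged (fun i => 'I_(n i).+1) (w i)) | i < k].

Definition fH {T : Type} (f : k.-tuple T -> R[i]) (x : Jt k n -> T) : R[i] :=
  \prod_(w : Vt k n)
     (cpow (f (hproj w x)) (alpha w) * Num.conj (cpow (f (hproj w x)) (beta w))).

Context {d : measure_display} {T : measurableType d}.
Variable mu : {measure set T -> \bar R}.

Definition normH (f : k.-tuple T -> R[i]) : R[i] :=
  cpow (cint mu (fH f)) (hsize alpha beta)^-1.

Definition cmeasurable (f : k.-tuple T -> R[i]) : Prop :=
  measurable_fun setT (fun t => complex.Re (f t)) /\ measurable_fun setT (fun t => complex.Im (f t)).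

(* L_H(M): measurable f with || |f| ||_H < oo, i.e. int |f|^H < oo *)
Definition inLH (f : k.-tuple T -> R[i]) : Prop :=
  cmeasurable f /\
  (iint mu (fun x => (complex.Re (fH (fun t => (cmod (f t))%:C%C) x))%:E) < +oo)%E.

Definition seminorm_on_LH : Prop :=
  [/\ (forall f g, inLH f -> inLH g -> inLH (fun t => f t + g t)),
      (forall (c : R[i]) f, inLH f -> inLH (fun t => c * f t)),
      (forall f, inLH f -> 0 <= normH f),
      (forall f g, inLH f -> inLH g ->
          normH (fun t => f t + g t) <= normH f + normH g) &
      (forall (c : R[i]) f, inLH f -> normH (fun t => c * f t) = `|c| * normH f)].

End HomDensity.

Definition semi_norming {R : realType} {k : nat} {n : 'I_k -> nat}
    (alpha beta : Vt k n -> R) : Prop :=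
  (forall w, 0 <= alpha w) /\ (forall w, 0 <= beta w) /\
  forall (d : measure_display) (T : measurableType d)
         (mu : {measure set T -> \bar R}),
    sigma_finite setT mu -> seminorm_on_LH alpha beta mu.

Section Moduli.
Context {R : realType} {X : Type}.
Variables (S : set (X -> R[i])) (nrm : (X -> R[i]) -> R).

Definition mod_smooth (tau : R) : \bar R :=
  ereal_sup [set e | exists x y, [/\ S x, S y, nrm x = 1, nrm y = 1 &
     e = ((nrm (fun t => x t - tau%:C%C * y t) +
           nrm (fun t => x t + tau%:C%C * y t)) / 2 - 1)%:E]].

Definition mod_convex (eps : R) : \bar R :=
  ereal_inf [set e | exists x y, [/\ S x /\ S y, nrm x = 1, nrm y = 1,
     2 * eps <= nrm (fun t => x t - y t) &
     e = (1 - nrm (fun t => (2^-1)%:C%C * (x t + y t)))%:E]].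

Definition unif_smooth (t : R) : Prop :=
  exists C : R, 0 < C /\ forall tau, 0 < tau -> (mod_smooth tau <= (powR (C * tau) t)%:E)%E.

Definition unif_convex (r : R) : Prop :=
  exists C : R, 0 < C /\
    forall eps, 0 <= eps <= 1 -> ((powR (eps / C) r)%:E <= mod_convex eps)%E.

End Moduli.

Definition ellH {R : realType} {k : nat} {n : 'I_k -> nat}
  (alpha beta : Vt k n -> R) : set (k.-tuple nat -> R[i]) :=
  inLH alpha beta (@counting nat R).

Definition ellH_norm {R : realType} {k : nat} {n : 'I_k -> nat}
  (alpha beta : Vt k n -> R) (f : k.-tuple nat -> R[i]) : R :=
  complex.Re (normH alpha beta (@counting nat R) f).

(* Main.v *)
(* Only the restrictions of the hypothesis to the finite counting measures
   [\delta_0 + ... + \delta_(N - 1)] and to the counting measure are needed.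
   Over the former every integral is a finite sum, and these sums converge to
   the integral over the counting measure, so it suffices to prove estimates
   that are uniform in [N].
   The triangle inequality gives the Hoelder-type inequality
   [|\int \prod f_w| <= 1 whenever ||f_w||_H <= 1] by the tensor power trick:
   a bound by a constant, valid for all [N], improves to [1] upon replacing the
   [f_w] by their tensor powers, which live on the [N * N]-point space.
   In Type II, expanding [(f + l g)^H + (f - l g)^H] leaves only the terms with
   an even number of [g]'s, hence
     [||f + l g||^m + ||f - l g||^m <= (1 + l)^m + (1 - l)^m],  [m = |H|],
   which yields smoothness for small [l] and convexity for [l = 1].
   In Type I, [|f + tau g|^s] is first bounded pointwise by a term even in [g],
   plus one odd in [g], and the same expansion applies.  For convexity, a
   pointwise two-point inequality is multiplied over the edges; the exponent
   [|H|] comes from [s / 2 * m >= 1], where [m] is the number of edges. *)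

Require Import Defs.
From HB Require Import structures.
From mathcomp Require Import all_boot all_order all_algebra.
From mathcomp Require Import all_classical all_reals all_analysis.
From mathcomp Require Import complex ring lra.
Import Order.TTheory GRing.Theory Num.Theory numFieldNormedType.Exports.
Local Open Scope ring_scope.
Set Implicit Arguments. Unset Strict Implicit. Unset Printing Implicit Defensive.

(** * Scalar inequalities for real powers *)

Section PowerInequalities.
Context {R : realType}.
Implicit Types (x y z a b c p s t r u tau : R).

Lemma ler_powRl p x y : 0 <= p -> 0 <= x -> x <= y -> x `^ p <= y `^ p.
Proof.
move=> p0 x0 xy; apply: ge0_ler_powR => //; rewrite nnegrE //; exact: le_trans xy.
Qed.

(** Bernoulli's inequality. With [y] the right-hand side, [ln z <= z - 1] is used at [x / y] and
    [1 / y] with weights [p] and [1 - p]; the upper bounds cancel and leave [p * ln x <= ln y]. *)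
Lemma powR_concave_at1 p x : 0 <= p <= 1 -> 0 <= x -> x `^ p <= 1 + p * (x - 1).
Proof.
move=> /andP[p0 p1]; rewrite le_eqVlt => /predU1P[<-|x0].
  by have [->|pn0] := eqVneq p 0; [rewrite powRr0; lra | rewrite powR0//; lra].
set y := 1 + p * (x - 1).
have y0 : 0 < y.
  rewrite /y; have [->|pn0] := eqVneq p 0; first by lra.
  have pp : 0 < p by rewrite lt_neqAle eq_sym pn0.
  by have := mulr_gt0 pp x0; lra.
have lnle z : 0 < z -> ln z <= z - 1.
  by move=> z0; have := @le_ln1Dx R (z - 1); rewrite (_ : 1 + (z - 1) = z); [apply; lra|ring].
have xy : 0 < x / y by rewrite divr_gt0.
have iy : 0 < y^-1 by rewrite invr_gt0.
have := lnle _ xy; have := lnle _ iy.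
rewrite lnM ?posrE// lnV ?posrE// => h1 h2.
have e : p * (x / y) + (1 - p) * y^-1 = 1 by rewrite /y; field; rewrite -/y; lra.
have h3 : p * (ln x - ln y) + (1 - p) * (- ln y) <= 0.
  apply: (@le_trans _ _ (p * (x / y - 1) + (1 - p) * (y^-1 - 1))).
    by apply: lerD; apply: ler_wpM2l => //; lra.
  by rewrite !mulrBr; lra.
rewrite /powR gt_eqF// -[leRHS]lnK ?posrE// ler_expR; lra.
Qed.

(** This is the concave case for the exponent [p^-1] at the point x ^ p. *)
Lemma powR_convex_at1 p x : 1 <= p -> 0 <= x -> 1 + p * (x - 1) <= x `^ p.
Proof.
move=> p1 x0; have pp : 0 < p by lra.
have := @powR_concave_at1 p^-1 (x `^ p); rewrite -powRrM mulfV ?gt_eqF// powRr1//.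
have h : 0 <= p^-1 <= 1 by rewrite invr_ge0 ltW//= invf_le1//.
move=> /(_ h (powR_ge0 _ _)) hx.
have : p * x <= p * (1 + p^-1 * (x `^ p - 1)) by rewrite ler_wpM2l// ltW.
by rewrite mulrDr mulrA mulfV ?gt_eqF//; lra.
Qed.

Lemma powR_scale p u x : 0 < u -> 0 <= x -> x `^ p = u `^ p * (x / u) `^ p.
Proof.
move=> u0 x0; rewrite -powRM ?(ltW u0) ?divr_ge0 ?(ltW u0)//.
by rewrite mulrCA mulfV ?gt_eqF// mulr1.
Qed.

Lemma powR_concave_tangent p u x : 0 <= p <= 1 -> 0 < u -> 0 <= x ->
  x `^ p <= u `^ p + p * (u `^ p / u) * (x - u).
Proof.
move=> p01 u0 x0; rewrite (powR_scale p u0 x0).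
have := @powR_concave_at1 p (x / u) p01 (divr_ge0 x0 (ltW u0)).
move/(ler_wpM2l (powR_ge0 u p)) => /le_trans; apply.
by rewrite le_eqVlt; apply/orP; left; apply/eqP; field; rewrite gt_eqF.
Qed.

Lemma powR_convex_tangent p u x : 1 <= p -> 0 < u -> 0 <= x ->
  u `^ p + p * (u `^ p / u) * (x - u) <= x `^ p.
Proof.
move=> p1 u0 x0; rewrite (powR_scale p u0 x0).
have := @powR_convex_at1 p (x / u) p1 (divr_ge0 x0 (ltW u0)).
move/(ler_wpM2l (powR_ge0 u p)); apply: le_trans.
by rewrite le_eqVlt; apply/orP; left; apply/eqP; field; rewrite gt_eqF.
Qed.

Lemma powR_midpoint_convex p x y : 1 <= p -> 0 <= x -> 0 <= y ->
  ((x + y) / 2) `^ p <= (x `^ p + y `^ p) / 2.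
Proof.
move=> p1 x0 y0; set w := (x + y) / 2.
have : 0 <= w by rewrite /w; lra.
rewrite le_eqVlt => /predU1P[<-|w0].
  rewrite powR0 ?gt_eqF//; last lra.
  by have := powR_ge0 x p; have := powR_ge0 y p; lra.
have hx := powR_convex_tangent p1 w0 x0.
have hy := powR_convex_tangent p1 w0 y0.
have e : p * (w `^ p / w) * (x - w) + p * (w `^ p / w) * (y - w) = 0.
  by rewrite -mulrDr (_ : x - w + (y - w) = 0) ?mulr0// /w; field.
lra.
Qed.

Lemma powR_superadditive p x y : 1 <= p -> 0 <= x -> 0 <= y ->
  x `^ p + y `^ p <= (x + y) `^ p.
Proof.
move=> p1 x0 y0.
have p0 : 0 < p by lra.
rewrite -(mulr_powRB1 x0 p0) -(mulr_powRB1 y0 p0) -(mulr_powRB1 (addr_ge0 x0 y0) p0).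
by rewrite mulrDl; apply: lerD; apply: ler_wpM2l => //; apply: ler_powRl; lra.
Qed.

(** Both [a - b] and [a + b] are convex combinations of [a - c] and [a + c], so by concavity the
    wider pair has the smaller sum. *)
Lemma powR_concave_spread p a b c : 0 < p <= 1 -> `|b| <= c -> c <= a ->
  (a - c) `^ p + (a + c) `^ p <= (a - b) `^ p + (a + b) `^ p.
Proof.
move=> /andP[p0 p1] bc ca.
have := bc; rewrite ler_norml => /andP[b1 b2].
have [c0|cn0] := eqVneq c 0; first by (have -> : b = 0 by lra); rewrite c0.
have cp : 0 < c by rewrite lt_neqAle eq_sym cn0 (le_trans _ bc).
(* Jensen's inequality on the chord from [a - c] to [a + c], obtained from the tangent at [a + e].
   The tangent lemma asks for a positive base point, so [a + e = 0] is treated apart. *)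
have key : forall e, `|e| <= c -> (2 * c) * (a + e) `^ p >=
    (c + e) * (a + c) `^ p + (c - e) * (a - c) `^ p.
  move=> e; rewrite ler_norml => /andP[e1 e2].
  have : 0 <= a + e by lra.
  rewrite le_eqVlt => /predU1P[w0|w0].
    have ec : e = - c by lra.
    by rewrite -w0 (_ : a - c = 0) ?powR0 ?gt_eqF// ?ec; [rewrite subrr !(mul0r, mulr0) addr0|lra].
  have h p' : 0 <= p' -> p' `^ p <= (a + e) `^ p + p * ((a + e) `^ p / (a + e)) * (p' - (a + e)).
    by move=> ?; apply: powR_concave_tangent => //; lra.
  set K := p * _ in h.
  have h1 : 0 <= a + c by lra. have h2 : 0 <= a - c by lra.
  have g1 : (c + e) * (a + c) `^ p <= (c + e) * ((a + e) `^ p + K * (a + c - (a + e))).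
    by apply: ler_wpM2l; [lra|exact: h].
  have g2 : (c - e) * (a - c) `^ p <= (c - e) * ((a + e) `^ p + K * (a - c - (a + e))).
    by apply: ler_wpM2l; [lra|exact: h].
  apply: le_trans (lerD g1 g2) _; rewrite le_eqVlt; apply/orP; left; apply/eqP; ring.
have k1 := key b bc; have k2 := key (- b); rewrite normrN in k2; have {}k2 := k2 bc.
have c2 : 0 < 2 * c by lra.
rewrite -(ler_pM2l c2); lra.
Qed.

(* The quadratic gain comes from writing [r ^ s = r * r ^ (s - 1)] and bounding *)
(* [(1 / r) ^ (s - 1)] from above by Bernoulli's inequality. *)
Lemma powR_strong_tangent s r : 1 < s <= 2 -> 0 <= r <= 2 ->
  1 + s * (r - 1) + (s - 1) ^+ 2 / 2 * (r - 1) ^+ 2 <= r `^ s.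
Proof.
move=> /andP[s1 s2] /andP[r0 r2].
move: r0; rewrite le_eqVlt => /predU1P[<-|r0].
  by rewrite powR0; [nra | rewrite gt_eqF//; lra].
set h := s - 1; have h0 : 0 < h by rewrite /h; lra.
have h1 : h <= 1 by rewrite /h; lra.
have ir : 0 <= r^-1 by rewrite invr_ge0 ltW.
have h01 : 0 <= h <= 1 by rewrite ltW.
have := powR_concave_at1 h01 ir.
have -> : r^-1 `^ h = (r `^ h)^-1 by rewrite -(powR_inv1 (ltW r0)) -powRrM mulN1r powRN.
move=> hb.
have rh : 0 < r `^ h by apply: powR_gt0.
have D0 : 0 < r + h * (1 - r) by nra.
(* Bernoulli's bound on (1 / r) ^ h, multiplied by r * r ^ h. *)
have rhl : r <= r `^ h * (r + h * (1 - r)).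
  have : r * r `^ h * (r `^ h)^-1 <= r * r `^ h * (1 + h * (r^-1 - 1)).
    by apply: ler_wpM2l => //; rewrite mulr_ge0 ?ltW.
  rewrite -mulrA mulfV ?gt_eqF// mulr1 => /le_trans; apply.
  by rewrite le_eqVlt; apply/orP; left; apply/eqP; field; rewrite gt_eqF.
have -> : r `^ s = r * r `^ h.
  by rewrite -(mulr_powRB1 (ltW r0)) //; lra.
rewrite -(ler_pM2r D0) -[leRHS]mulrA.
apply: (@le_trans _ _ (r * r)); last by apply: ler_wpM2l => //; exact: ltW.
have -> : s = 1 + h by rewrite /h; ring.
(* After multiplication by the positive [r + h * (1 - r)] the gap factors explicitly; its last
   factor is nonnegative because [r <= 2] forces [r + h * (1 - r) <= 2]. *)
have e : r * r - (1 + (1 + h) * (r - 1) + h ^+ 2 / 2 * (r - 1) ^+ 2) * (r + h * (1 - r))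
  = h ^+ 2 * (r - 1) ^+ 2 * (1 - (r + h * (1 - r)) / 2) by field.
have D2 : r + h * (1 - r) <= 2 by nra.
have : 0 <= h ^+ 2 * (r - 1) ^+ 2 * (1 - (r + h * (1 - r)) / 2).
  apply: mulr_ge0; first by rewrite mulr_ge0 ?sqr_ge0.
  lra.
lra.
Qed.

(** Averaging [powR_strong_tangent] at [1 + t] and [1 - t] cancels the linear terms. *)
Lemma powR_two_point s t : 1 < s <= 2 -> 0 <= t <= 1 ->
  1 + (s - 1) ^+ 2 / 2 * t ^+ 2 <= ((1 + t) `^ s + (1 - t) `^ s) / 2.
Proof.
move=> hs /andP[t0 t1].
have := @powR_strong_tangent s (1 + t) hs; have := @powR_strong_tangent s (1 - t) hs.
have h1 : 0 <= 1 - t <= 2 by apply/andP; split; lra.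
have h2 : 0 <= 1 + t <= 2 by apply/andP; split; lra.
by move=> /(_ h1) + /(_ h2); rewrite !expr2; lra.
Qed.

(** Induction on an integer bound for [p]. The range of [r] is chosen for [powR_smooth_pointwise],
    where [1 + r] is a ratio of squared moduli lying in [0, 4]. *)
Lemma powR_quadratic_upper p : 0 <= p -> exists2 C : R, 0 <= C &
  forall r, -1 <= r <= 3 -> (1 + r) `^ p <= 1 + p * r + C * r ^+ 2.
Proof.
move=> p0.
have [N] : exists N : nat, p <= N%:R by exists (Num.bound p); rewrite ltW// archi_boundP.
elim: N p p0 => [|N IH] p p0 pN.
  exists 0 => // r hr; have -> : p = 0 by lra.
  by rewrite powRr0; lra.
have [p1|p1] := lerP p 1.
  exists 0 => // r /andP[r1 r3].
  have p01 : 0 <= p <= 1 by rewrite p0.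
  have r0 : 0 <= 1 + r by lra.
  by have := powR_concave_at1 p01 r0; lra.
have [||C C0 hC] := IH (p - 1); [lra | by rewrite -natr1 in pN; lra |].
(* Multiplying the bound for [p - 1] by [1 + r] gives the quadratic term [(p - 1) * r ^ 2] and the
   remainder [C * r ^ 2 * (1 + r)], where [1 + r <= 4]. *)
exists (p - 1 + 4 * C); first by lra.
move=> r /[dup] hr /andP[r1 r3]; have := hC r hr.
have r0 : 0 <= 1 + r by lra.
rewrite -(@mulr_powRB1 _ _ p r0); last by lra.
move/(ler_wpM2l r0) => /le_trans; apply.
have : 0 <= C * r ^+ 2 * (3 - r) by apply: mulr_ge0; [rewrite mulr_ge0 ?sqr_ge0 | lra].
rewrite !expr2; lra.
Qed.

Lemma powRM_exp2 x p : 0 <= x -> (x ^+ 2) `^ (p / 2) = x `^ p.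
Proof.
by move=> x0; rewrite -powR_mulrn// -powRrM; congr (_ `^ _); field.
Qed.

Lemma powR_pinch p x z : 2 <= p -> 0 <= x -> 0 <= z ->
  x `^ (p - 2) * z ^+ 2 <= x `^ p + z `^ p.
Proof.
move=> p2 x0 z0; have pp : 0 < p by lra.
have main w : 0 <= w -> w `^ (p - 2) * w ^+ 2 = w `^ p.
  rewrite le_eqVlt => /predU1P[<-|w0]; first by rewrite expr2 !mulr0 powR0// gt_eqF.
  rewrite -powR_mulrn ?ltW// -powRD; first by congr (_ `^ _); ring.
  by rewrite (gt_eqF w0) implybT.
have [xz|zx] := lerP x z.
  apply: (@le_trans _ _ (z `^ p)); last by rewrite lerDr powR_ge0.
  by rewrite -[leRHS]main// ler_wpM2r ?sqr_ge0// ler_powRl//; lra.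
apply: (@le_trans _ _ (x `^ p)); last by rewrite lerDl powR_ge0.
by rewrite -[leRHS]main// ler_wpM2l ?powR_ge0// ler_sqr ?nnegrE// ltW.
Qed.

(** Bounds the linear term of [powR_smooth_pointwise]: x ^ (s - 1) * z is at most max(x, z) ^ s. At
    [x = 0] the hypothesis forces [c = 0]. *)
Lemma powR_mix1 s x z c : 1 <= s -> 0 <= x -> 0 <= z -> `|c| <= x * z ->
  `|s * (x `^ s / x ^+ 2) * c| <= s * (x `^ s + z `^ s).
Proof.
move=> s1 x0 z0 hc; have sp : 0 < s by lra.
have S0 : 0 <= x `^ s + z `^ s by rewrite addr_ge0 ?powR_ge0.
move: x0 (x0); rewrite {1}le_eqVlt => /predU1P[x00|xp] x0.
  have -> : c = 0 by apply/eqP; rewrite -normr_le0 (le_trans hc)// -x00 mul0r.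
  by rewrite mulr0 normr0 mulr_ge0// ltW.
have k0 : 0 <= x `^ s / x ^+ 2 by rewrite divr_ge0 ?powR_ge0 ?sqr_ge0.
rewrite -mulrA normrM (gtr0_norm sp) normrM (ger0_norm k0).
apply: ler_wpM2l; first exact: ltW.
apply: le_trans (ler_wpM2l k0 hc) _.
have -> : x `^ s / x ^+ 2 * (x * z) = x `^ (s - 1) * z.
  rewrite -(@mulr_powRB1 _ x s) //; field; by rewrite gt_eqF.
have [xz|zx] := lerP x z.
  apply: (@le_trans _ _ (z `^ s)); last by rewrite lerDr powR_ge0.
  by rewrite -(mulr_powRB1 z0 sp) mulrC ler_wpM2l// ler_powRl//; lra.
apply: (@le_trans _ _ (x `^ s)); last by rewrite lerDl powR_ge0.
by rewrite -(mulr_powRB1 x0 sp) mulrC ler_wpM2r ?powR_ge0// ltW.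
Qed.

(* [x = |f|], [z = |g|], [c = Re (f^* g)], so that the left-hand side is *)
(* [|f + tau g| ^ s]; the term linear in [c] is odd in [tau g]. *)
Lemma powR_smooth_pointwise s t : 1 < s -> 1 <= t -> t <= s -> t <= 2 ->
    (t = s \/ t = 2) ->
  exists2 C : R, 0 <= C & forall x z c tau, 0 <= x -> 0 <= z -> `|c| <= x * z ->
    0 < tau <= 1 ->
    (x ^+ 2 + 2 * (tau * c) + (tau * z) ^+ 2) `^ (s / 2) <=
      x `^ s + tau * (s * (x `^ s / x ^+ 2) * c) + C * tau `^ t * (x `^ s + z `^ s).
Proof.
move=> s1 t1 ts t2 tE.
have s0 : 0 < s by lra.
have p0 : 0 <= s / 2 by lra.
have [C1 C10 hC1] := powR_quadratic_upper p0.
(* The first bracket serves the case [x <= tau * z], the second the case [tau * z < x]. *)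
pose C := (2 `^ s + s) + (s / 2 + 9 * C1).
have s2p : 0 <= 2 `^ s :> R := powR_ge0 _ _.
exists C; first by rewrite /C; lra.
move=> x z c tau x0 z0 hc /andP[tau0 tau1].
have tz0 : 0 <= tau * z by rewrite mulr_ge0// ltW.
have hc' : `|tau * c| <= x * (tau * z).
  by rewrite normrM gtr0_norm// mulrCA ler_wpM2l// ltW.
have S0 : 0 <= x `^ s + z `^ s by rewrite addr_ge0 ?powR_ge0.
have tt0 : 0 <= tau `^ t := powR_ge0 _ _.
have tsE : (tau * z) `^ s <= tau `^ t * (x `^ s + z `^ s).
  rewrite powRM ?(ltW tau0)//; apply: ler_pM; rewrite ?powR_ge0//.
    by apply: ger_powR => //; rewrite tau0.
  by rewrite lerDr powR_ge0.
have lift D : 0 <= D -> D <= C ->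
    D * (tau `^ t * (x `^ s + z `^ s)) <= C * tau `^ t * (x `^ s + z `^ s).
  by move=> D0 DC; rewrite -mulrA ler_wpM2r// mulr_ge0.
have posA : 0 <= x ^+ 2 + 2 * (tau * c) + (tau * z) ^+ 2.
  move: hc'; rewrite ler_norml => /andP[h1 h2].
  have := sqr_ge0 (x - tau * z); rewrite !expr2; lra.
have upA : x ^+ 2 + 2 * (tau * c) + (tau * z) ^+ 2 <= (x + tau * z) ^+ 2.
  move: hc'; rewrite ler_norml => /andP[h1 h2]; rewrite !expr2; lra.
have [tzx|xtz] := lerP x (tau * z).
  have up1 : (x ^+ 2 + 2 * (tau * c) + (tau * z) ^+ 2) `^ (s / 2) <= 2 `^ s * (tau * z) `^ s.
    have ttz0 : 0 <= 2 * (tau * z) by lra.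
    rewrite -powRM// -(powRM_exp2 _ ttz0).
    apply: ler_powRl => //; apply: le_trans upA _.
    by rewrite ler_sqr ?nnegrE ?(addr_ge0 x0 tz0)//; lra.
  have lin : - (s * (tau * z) `^ s) <= tau * (s * (x `^ s / x ^+ 2) * c).
    move: x0; rewrite le_eqVlt => /predU1P[x0|x0].
      have -> : c = 0 by apply/eqP; rewrite -normr_le0 (le_trans hc)// -x0 mul0r.
      by rewrite !mulr0 oppr_le0 mulr_ge0 ?powR_ge0// ltW.
    have k0 : 0 <= s * (x `^ s / x ^+ 2).
      by rewrite mulr_ge0 ?divr_ge0 ?powR_ge0 ?sqr_ge0// ltW.
    have : - (s * (x `^ s / x ^+ 2) * (x * (tau * z))) <= tau * (s * (x `^ s / x ^+ 2) * c).
      rewrite [leRHS]mulrCA -mulrN; apply: ler_wpM2l => //.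
      by move: hc'; rewrite ler_norml => /andP[].
    apply: le_trans; rewrite lerN2 -mulrA; apply: ler_wpM2l; first exact: ltW.
    have -> : x `^ s / x ^+ 2 * (x * (tau * z)) = x `^ (s - 1) * (tau * z).
      rewrite -(@mulr_powRB1 _ x s) ?ltW//.
      by field; rewrite gt_eqF.
    by rewrite -(mulr_powRB1 tz0 s0) mulrC ler_wpM2l// ler_powRl//; lra.
  have D0 : 0 <= 2 `^ s + s by lra.
  have DC : 2 `^ s + s <= C by rewrite /C; lra.
  have := le_trans (ler_wpM2l D0 tsE) (lift _ D0 DC).
  rewrite mulrDl => h; apply: le_trans up1 _; have := powR_ge0 x s; lra.
have x1 : 0 < x by lra.
have F0 : 0 < x ^+ 2 by rewrite exprn_gt0.
(* The relative increment of the squared modulus: |f + tau g| ^ 2 = |f| ^ 2 * (1 + r), and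
   [tau * z < x] keeps [1 + r <= 4]. *)
set r := (2 * (tau * c) + (tau * z) ^+ 2) / x ^+ 2.
have AE : x ^+ 2 + 2 * (tau * c) + (tau * z) ^+ 2 = x ^+ 2 * (1 + r).
  by rewrite /r; field; rewrite gt_eqF.
have hr : -1 <= r <= 3.
  apply/andP; split.
    have : 0 <= x ^+ 2 * (1 + r) by rewrite -AE.
    by rewrite pmulr_rge0//; lra.
  have : x ^+ 2 * (1 + r) <= x ^+ 2 * 4.
    rewrite -AE; apply: le_trans upA _.
    have -> : x ^+ 2 * 4 = (x + x) ^+ 2 by rewrite !expr2; ring.
    by rewrite ler_sqr ?nnegrE; lra.
  by rewrite ler_pM2l//; lra.
have xs0 := powR_ge0 x s.
(* The second-order remainder. If [t = 2] then [2 <= s] and [powR_pinch] applies; if [t = s <= 2],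
   the exponent [s - 2] is nonpositive and [tau * z < x] allows replacing [x] by [tau * z]. *)
have quad : x `^ s / x ^+ 2 * (tau * z) ^+ 2 <= tau `^ t * (x `^ s + z `^ s).
  have xE : x `^ s / x ^+ 2 = x `^ (s - 2).
    rewrite powRB ?(gt_eqF x1) ?implybT// ; by rewrite powR_mulrn// ltW.
  rewrite xE; case: tE => tE; last first.
    have -> : tau `^ t = tau ^+ 2 by rewrite tE powR_mulrn// ltW.
    rewrite exprMn mulrCA; apply: ler_wpM2l; first exact: sqr_ge0.
    by apply: powR_pinch => //; lra.
  apply: le_trans tsE.
  move: tz0; rewrite le_eqVlt => /predU1P[<-|tz0]; first by rewrite expr2 !mulr0 powR_ge0.
  have -> : (tau * z) `^ s = (tau * z) `^ (s - 2) * (tau * z) ^+ 2.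
    rewrite -powR_mulrn ?ltW// -powRD ?(gt_eqF tz0) ?implybT//.
    by congr (_ `^ _); ring.
  apply: ler_wpM2r; first exact: sqr_ge0.
  rewrite -[s - 2]opprB !powRN lef_pV2 ?posrE ?powR_gt0//.
  by apply: ler_powRl; lra.
rewrite AE powRM ?(ltW F0)//; last by case/andP: hr; lra.
rewrite powRM_exp2//.
have := ler_wpM2l xs0 (hC1 r hr) => /le_trans; apply.
(* The two terms of [r * x] are at most [2 * tau * z] and [tau * z], whence the 3 and its square
   9. *)
have r2 : r ^+ 2 <= 9 * (tau * z) ^+ 2 / x ^+ 2.
  have rb : `|r| * x <= 3 * (tau * z).
    have -> : `|r| * x = `|2 * (tau * c) + (tau * z) ^+ 2| / x.
      by rewrite /r normrM normfV (gtr0_norm F0); field; rewrite gt_eqF.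
    rewrite ler_pdivrMr//.
    apply: le_trans (ler_normD _ _) _.
    rewrite normrM (ger0_norm (sqr_ge0 _)) ger0_norm//.
    have : (tau * z) ^+ 2 <= tau * z * x by rewrite expr2 ler_wpM2l// ltW.
    lra.
  rewrite ler_pdivlMr// -(ger0_norm (sqr_ge0 r)) normrX -exprMn.
  have -> : 9 * (tau * z) ^+ 2 = (3 * (tau * z)) ^+ 2 by rewrite !expr2; ring.
  have n0 : 0 <= `|r| * x by rewrite mulr_ge0.
  by rewrite ler_sqr ?nnegrE//; lra.
have h1 : x `^ s * (C1 * r ^+ 2) <= 9 * C1 * (x `^ s / x ^+ 2 * (tau * z) ^+ 2).
  have := ler_wpM2l (mulr_ge0 xs0 C10) r2; rewrite mulrA => /le_trans; apply.
  by rewrite le_eqVlt; apply/orP; left; apply/eqP; field; rewrite gt_eqF.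
have h2 : x `^ s * (s / 2 * r) =
    tau * (s * (x `^ s / x ^+ 2) * c) + s / 2 * (x `^ s / x ^+ 2 * (tau * z) ^+ 2).
  by rewrite /r; field; rewrite gt_eqF.
rewrite !mulrDr mulr1 h2.
have D0 : 0 <= s / 2 + 9 * C1 by lra.
have DC : s / 2 + 9 * C1 <= C by rewrite /C; lra.
have := le_trans (ler_wpM2l D0 quad) (lift _ D0 DC).
rewrite mulrDl => h; lra.
Qed.

(** Since [s / 2 <= 1], the power is concave, and the average on the right is smallest at the
    extreme value [c = x * y], that is, for collinear vectors. *)
Lemma powR_parallelogram_spread s x y c : 1 < s <= 2 -> 0 <= x -> 0 <= y ->
    `|c| <= x * y ->
  ((x + y) `^ s + `|x - y| `^ s) / 2 <=
  ((x ^+ 2 + y ^+ 2 - 2 * c) `^ (s / 2) + (x ^+ 2 + y ^+ 2 + 2 * c) `^ (s / 2)) / 2.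
Proof.
move=> /andP[s1 s2] x0 y0 hc; apply: ler_wpM2r; first by rewrite invr_ge0.
have p01 : 0 < s / 2 <= 1 by apply/andP; split; lra.
have hc2 : `|2 * c| <= 2 * (x * y) by rewrite normrM ger0_norm//; lra.
have h : 2 * (x * y) <= x ^+ 2 + y ^+ 2 by have := sqr_ge0 (x - y); rewrite !expr2; lra.
have := powR_concave_spread p01 hc2 h; apply: le_trans.
rewrite addrC le_eqVlt; apply/orP; left; apply/eqP; congr (_ + _).
  rewrite -powRM_exp2// real_normK ?num_real//; congr (_ `^ _); ring.
by rewrite -powRM_exp2 ?addr_ge0//; congr (_ `^ _); ring.
Qed.

Lemma powR_two_point_scaled s x y : 1 < s <= 2 -> 0 <= y -> y <= x -> 0 < x ->
  x `^ s * (1 + (s - 1) ^+ 2 / 2 * (y / x) ^+ 2) <= ((x + y) `^ s + `|x - y| `^ s) / 2.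
Proof.
move=> hs y0 yx x0.
have yx0 : 0 <= y / x by rewrite divr_ge0// ltW.
have yx1 : y / x <= 1 by rewrite ler_pdivrMr// mul1r.
have h : 0 <= y / x <= 1 by rewrite yx0.
have := ler_wpM2l (powR_ge0 x s) (powR_two_point hs h) => /le_trans; apply.
rewrite mulrA; apply: ler_wpM2r; first by rewrite invr_ge0.
rewrite ger0_norm ?subr_ge0// mulrDr -!powRM ?(ltW x0)//; [|lra|lra].
by rewrite !mulrDr mulrN mulr1 mulrC mulfVK ?gt_eqF.
Qed.

(* [x = |u|], [y = |v|], [c = Re (u^* v)], so that [B] is the average of *)
(* [|u + v| ^ s] and [|u - v| ^ s]. *)
Lemma powR_convex_pointwise s : 1 < s ->
  exists2 c0 : R, 0 < c0 <= 1 & forall x y c, 0 <= x -> 0 <= y -> `|c| <= x * y ->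
    let B := ((x ^+ 2 + y ^+ 2 - 2 * c) `^ (s / 2) + (x ^+ 2 + y ^+ 2 + 2 * c) `^ (s / 2)) / 2 in
    exists r, [/\ 0 <= r <= 1, x `^ s <= (1 - c0 * r) * B &
      y `^ s <= r `^ Num.min 1 (s / 2) * B].
Proof.
move=> s1.
have [s2|s2] := lerP 2 s.
  exists 1; first by rewrite ltr01 lexx.
  move=> x y c x0 y0 hc B.
  have p1 : 1 <= s / 2 by lra.
  have hq : `|2 * c| <= x ^+ 2 + y ^+ 2.
    rewrite normrM ger0_norm//; apply: le_trans (_ : 2 * (x * y) <= _).
      by rewrite ler_wpM2l.
    have := sqr_ge0 (x - y); rewrite !expr2; lra.
  (* A Clarkson inequality for [2 <= s]: superadditivity, then midpoint convexity, of the power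
     [s / 2]. The share of y ^ s in [B] then serves as [r]. *)
  have xyB : x `^ s + y `^ s <= B.
    rewrite -(powRM_exp2 s x0) -(powRM_exp2 s y0).
    apply: le_trans (powR_superadditive p1 (sqr_ge0 _) (sqr_ge0 _)) _.
    move: hq; rewrite ler_norml => /andP[h1 h2].
    have a1 : 0 <= x ^+ 2 + y ^+ 2 - 2 * c by lra.
    have a2 : 0 <= x ^+ 2 + y ^+ 2 + 2 * c by lra.
    have := powR_midpoint_convex p1 a1 a2; apply: le_trans.
    by rewrite le_eqVlt; apply/orP; left; apply/eqP; congr (_ `^ _); field.
  have xs0 := powR_ge0 x s; have ys0 := powR_ge0 y s.
  have : 0 <= B by lra.
  rewrite le_eqVlt => /predU1P[B0|B0].
    exists 0; rewrite lexx ler01 mulr0; split => //; rewrite -B0; lra.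
  have q0 : 0 <= y `^ s / B := divr_ge0 ys0 (ltW B0).
  exists (y `^ s / B); split.
  - by rewrite q0/= ler_pdivrMr// mul1r; lra.
  - by rewrite mul1r mulrBl mul1r mulfVK ?gt_eqF//; lra.
  - rewrite min_l// powRr1//.
    by rewrite mulfVK ?gt_eqF.
have hs : 1 < s <= 2 by rewrite s1 ltW.
set k := (s - 1) ^+ 2 / 2.
have k0 : 0 < k by rewrite /k divr_gt0// exprn_gt0//; lra.
have k1 : k <= 1 / 2.
  rewrite /k ler_wpM2r ?invr_ge0//.
  rewrite -[leRHS](expr1n R 2) ler_sqr ?nnegrE//; lra.
have p20 : 0 < 2 `^ s :> R by apply: powR_gt0.
have p21 : 1 <= 2 `^ s :> R.
  by rewrite -[leLHS](powRr0 (2 : R)); apply: ler_powR; lra.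
(* The gain in [MB] below is a multiple [k / 2] of M ^ s; the bound B <= 2 ^ s * M ^ s turns it into
   a multiple of [B]. *)
exists (k / 2 / 2 `^ s).
  rewrite divr_gt0//=; last lra.
  by rewrite ler_pdivrMr// mul1r; lra.
move=> x y c x0 y0 hc B; set M := Num.max x y.
have xM : x <= M by rewrite le_max lexx.
have yM : y <= M by rewrite le_max lexx orbT.
have M0 : 0 <= M by rewrite (le_trans x0).
have BG := powR_parallelogram_spread hs x0 y0 hc; rewrite -/B in BG.
have B0 : 0 <= B by rewrite divr_ge0// addr_ge0 ?powR_ge0.
move: (M0); rewrite le_eqVlt => /predU1P[M00|Mp].
  have -> : x = 0 by lra. have -> : y = 0 by lra.
  exists 0; rewrite lexx ler01 mulr0 subr0 mul1r powR0 ?gt_eqF//; last lra.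
  by split => //; rewrite mulr_ge0 ?powR_ge0.
(* If [y <= x], this is the scaled two-point inequality. If [x < y], the second claim becomes t ^ s
   + k / 2 <= 1 + k * t ^ 2 with [t = x / y], which follows from t ^ s <= t and [k <= 1 / 2]. *)
have MB : M `^ s <= B /\ x `^ s + k / 2 * (y / M) ^+ 2 * M `^ s <= B.
  have [yx|xy] := lerP y x.
    have ME : M = x by rewrite /M max_l.
    rewrite ME in Mp |- *; have := le_trans (powR_two_point_scaled hs y0 yx Mp) BG.
    rewrite -/k mulrDr mulr1 => h.
    have : 0 <= x `^ s * (k * (y / x) ^+ 2).
      by rewrite mulr_ge0 ?powR_ge0// mulr_ge0 ?sqr_ge0// ltW.
    by move=> h'; split; lra.
  have ME : M = y by rewrite /M max_r// ltW.
  rewrite ME in Mp |- *; have := le_trans (powR_two_point_scaled hs x0 (ltW xy) Mp) _.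
  have BG' : ((y + x) `^ s + `|y - x| `^ s) / 2 <= B by rewrite distrC [y + x]addrC.
  move=> /(_ _ BG'); rewrite -/k => h.
  set t := x / y in h.
  have t0 : 0 <= t by rewrite /t divr_ge0.
  have t1 : t <= 1 by rewrite /t ler_pdivrMr// mul1r ltW.
  have ys0 := powR_ge0 y s.
  have h1 : 0 <= y `^ s * (k * t ^+ 2).
    by rewrite mulr_ge0// mulr_ge0 ?sqr_ge0// ltW.
  split; first lra.
  rewrite mulfV ?gt_eqF// expr1n mulr1.
  apply: le_trans h.
  have -> : x `^ s = y `^ s * t `^ s by rewrite (powR_scale s Mp x0).
  rewrite [k / 2 * _]mulrC -mulrDr; apply: ler_wpM2l => //.
  have ts : t `^ s <= t.
    have [->|tn0] := eqVneq t 0; first by rewrite powR0// gt_eqF//; lra.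
    by apply: ge1r_powR; [rewrite lt_neqAle eq_sym tn0 t0 t1|lra].
  have : 0 <= (1 / 2 - k) * (1 - t) by apply: mulr_ge0; lra.
  have : 0 <= k * (t - 1 / 2) ^+ 2 by rewrite mulr_ge0 ?sqr_ge0// ltW.
  rewrite !expr2; lra.
case: MB => MB xB.
have r0 : 0 <= y / M by rewrite divr_ge0// ltW.
have r1 : y / M <= 1 by rewrite ler_pdivrMr// mul1r.
(* With this [r], y ^ s = r ^ (s / 2) * M ^ s, and M ^ s <= B. *)
exists ((y / M) ^+ 2); split.
- by rewrite sqr_ge0//= -[leRHS](expr1n R 2) ler_sqr ?nnegrE.
- apply: (@le_trans _ _ (B - k / 2 * (y / M) ^+ 2 * M `^ s)); first lra.
  rewrite mulrBl mul1r lerD2l lerN2.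
  have BM : B <= 2 `^ s * M `^ s.
    have up e : e <= 2 * (x * y) -> 0 <= x ^+ 2 + y ^+ 2 + e ->
        (x ^+ 2 + y ^+ 2 + e) `^ (s / 2) <= 2 `^ s * M `^ s.
      move=> e1 e0; rewrite -powRM// -(powRM_exp2 s (_ : 0 <= 2 * M)); last by rewrite mulr_ge0.
      apply: ler_powRl => //; first lra.
      apply: (@le_trans _ _ ((x + y) ^+ 2)); first by rewrite !expr2; lra.
      by rewrite ler_sqr ?nnegrE ?mulr_ge0 ?addr_ge0//; lra.
    move: (hc); rewrite ler_norml => /andP[h1 h2].
    have h3 := sqr_ge0 (x - y); have h4 := sqr_ge0 (x + y); rewrite !expr2 in h3 h4.
    have u1 := up (- (2 * c)); have u2 := up (2 * c).
    have {}u1 : (x ^+ 2 + y ^+ 2 - 2 * c) `^ (s / 2) <= 2 `^ s * M `^ s.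
      by apply: u1; rewrite ?expr2; lra.
    have {}u2 : (x ^+ 2 + y ^+ 2 + 2 * c) `^ (s / 2) <= 2 `^ s * M `^ s.
      by apply: u2; rewrite ?expr2; lra.
    rewrite /B; lra.
  have -> : k / 2 / 2 `^ s * (y / M) ^+ 2 * B = k / 2 * (y / M) ^+ 2 * (B / 2 `^ s).
    by field; rewrite !gt_eqF.
  apply: ler_wpM2l.
    by rewrite mulr_ge0 ?sqr_ge0// divr_ge0// ltW.
  by rewrite ler_pdivrMr// mulrC.
- rewrite min_r; last lra.
  rewrite powRM_exp2//; apply: le_trans (ler_wpM2l (powR_ge0 _ _) MB).
  by rewrite -powRM// mulfVK ?gt_eqF.
Qed.

(** The terms linear in [tau] cancel in the sum, and [t <= 2] lets tau ^ t absorb tau ^ 2. The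
    induction on [m] also has to know that the difference of the two powers is O(tau), so both
    bounds are proved together. *)
Lemma powR_even_part a b t (m : nat) : 0 <= a -> 0 <= b -> 1 <= t <= 2 ->
  exists2 C : R, 0 <= C & forall tau, 0 < tau <= 1 ->
    (1 + a * tau `^ t + b * tau) ^+ m + (1 + a * tau `^ t - b * tau) ^+ m
      <= 2 * (1 + C * tau `^ t).
Proof.
move=> a0 b0 /andP[t1 t2].
suff [C C0 hC] : exists2 C : R, 0 <= C & forall tau, 0 < tau <= 1 ->
    (1 + a * tau `^ t + b * tau) ^+ m + (1 + a * tau `^ t - b * tau) ^+ m
      <= 2 * (1 + C * tau `^ t) /\
    (1 + a * tau `^ t + b * tau) ^+ m - (1 + a * tau `^ t - b * tau) ^+ m
      <= C * tau.
  by exists C => // tau /hC[].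
elim: m => [|m [C C0 IH]].
  by exists 0 => // tau _; rewrite !expr0; split; lra.
exists (a + C + a * C + b * C + b * 2 + b * 2 * C + (1 + a) * C).
  by rewrite !addr_ge0 ?mulr_ge0// addr_ge0.
move=> tau /[dup] /andP[tau0 tau1] /IH[].
rewrite !exprSr; set T := tau `^ t.
set X := (_ + _) ^+ m; set Y := (_ - _) ^+ m => hE hO.
have T0 : 0 <= T := powR_ge0 _ _.
have Tt : T <= tau by apply: ge1r_powR => //; rewrite tau0.
have tT : tau * tau <= T.
  by rewrite -expr2 -powR_mulrn ?(ltW tau0)//; apply: ger_powR => //; rewrite tau0.
have T1 : T <= 1 by lra.
have P0 : 0 <= 1 + a * T by have := mulr_ge0 a0 T0; lra.
have L0 : 0 <= b * tau by rewrite mulr_ge0// ltW.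
have PE := ler_wpM2l P0 hE; have LO := ler_wpM2l L0 hO.
have PO := ler_wpM2l P0 hO; have LE := ler_wpM2l L0 hE.
have aT := mulr_ge0 a0 T0; have bT := mulr_ge0 b0 T0; have CT := mulr_ge0 C0 T0.
have atau : 0 <= a * tau by rewrite mulr_ge0// ltW.
have Ctau : 0 <= C * tau by rewrite mulr_ge0// ltW.
have T1' : 0 <= 1 - T by lra.
have aCT : 0 <= a * C * T * (1 - T) by rewrite !mulr_ge0.
have aCT1 : 0 <= a * C * T by rewrite !mulr_ge0.
have bCT : 0 <= b * C * (T - tau * tau) by rewrite !mulr_ge0// subr_ge0.
have bCT1 : 0 <= b * C * T by rewrite !mulr_ge0.
have aCt : 0 <= a * C * tau by rewrite !mulr_ge0// ltW.
have bCt : 0 <= b * C * tau by rewrite !mulr_ge0// ltW.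
have aCt1 : 0 <= a * C * tau * (1 - T) by rewrite !mulr_ge0// ltW.
have bCt1 : 0 <= b * C * tau * (1 - T) by rewrite !mulr_ge0// ltW.
split; lra.
Qed.

End PowerInequalities.

(** * Complex powers *)

Section ComplexPower.
Context {R : realType}.
Local Open Scope complex_scope.
Implicit Types (z u v : R[i]) (a r : R).

Lemma normcE_cmod z : `|z| = (cmod z)%:C.
Proof. by case: z. Qed.

Lemma cmod_ge0 z : 0 <= cmod z.
Proof. exact: sqrtr_ge0. Qed.

Lemma cmodM u v : cmod (u * v) = cmod u * cmod v.
Proof. by apply: complexI; rewrite rmorphM /= -!normcE_cmod normrM. Qed.

Lemma cmodJ z : cmod (Num.conj z) = cmod z.
Proof. by case: z => a b; rewrite /cmod /= sqrrN. Qed.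

Lemma cmod0 : cmod (0 : R[i]) = 0.
Proof. by rewrite /cmod /= expr0n /= addr0 sqrtr0. Qed.

Lemma cmod_real r : 0 <= r -> cmod r%:C = r.
Proof. by move=> r0; rewrite /cmod /= expr0n addr0 sqrtr_sqr ger0_norm. Qed.

Lemma cmod_eq0 z : (cmod z == 0) = (z == 0).
Proof. by rewrite -(inj_eq (@complexI R)) -normcE_cmod normr_eq0. Qed.

Lemma cmod_gt0 z : z != 0 -> 0 < cmod z.
Proof. by move=> z0; rewrite lt_neqAle eq_sym cmod_eq0 z0 cmod_ge0. Qed.

Lemma cmod_sqr z : cmod z ^+ 2 = complex.Re z ^+ 2 + complex.Im z ^+ 2.
Proof. by rewrite sqr_sqrtr// addr_ge0 ?sqr_ge0. Qed.

Lemma mulcJ_cmod z : z * Num.conj z = (cmod z ^+ 2)%:C.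
Proof. by rewrite -normCK normcE_cmod rmorphXn. Qed.

(** The real part of conj(u) * v, that is, the Euclidean inner product of the plane. *)
Definition cdot u v : R :=
  complex.Re u * complex.Re v + complex.Im u * complex.Im v.

Lemma cmodD_sqr u v : cmod (u + v) ^+ 2 = cmod u ^+ 2 + 2 * cdot u v + cmod v ^+ 2.
Proof. by rewrite !cmod_sqr /cdot; case: u v => [a b] [c d] /=; ring. Qed.

Lemma cmodB_sqr u v : cmod (u - v) ^+ 2 = cmod u ^+ 2 - 2 * cdot u v + cmod v ^+ 2.
Proof. by rewrite !cmod_sqr /cdot; case: u v => [a b] [c d] /=; ring. Qed.

Lemma cdot_le u v : `|cdot u v| <= cmod u * cmod v.
Proof.
rewrite -ler_sqr ?nnegrE ?mulr_ge0 ?cmod_ge0// real_normK ?num_real//.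
rewrite exprMn !cmod_sqr /cdot -subr_ge0.
set A := _ - _.
have -> : A = (complex.Re u * complex.Im v - complex.Im u * complex.Re v) ^+ 2.
  by rewrite /A; ring.
exact: sqr_ge0.
Qed.

Lemma cos_sin_carg z : z != 0 ->
  cos (carg z) = complex.Re z / cmod z /\ sin (carg z) = complex.Im z / cmod z.
Proof.
move=> z0; have c0 := cmod_gt0 z0; have cs := cmod_sqr z.
set a := complex.Re z in cs *; set b := complex.Im z in cs *; set c := cmod z in c0 cs *.
have hs : (a / c) ^+ 2 + (b / c) ^+ 2 = 1.
  by rewrite !expr_div_n -mulrDl -cs mulfV// expf_neq0// gt_eqF.
have h1 : -1 <= a / c <= 1.
  rewrite -ler_norml -(@ler_pXn2r _ 2) ?nnegrE// expr1n real_normK ?num_real//.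
  by have := sqr_ge0 (b / c); lra.
have sE : sin (acos (a / c)) = `|b / c|.
  by rewrite sin_acos// -sqrtr_sqr; congr Num.sqrt; lra.
have cE : cos (acos (a / c)) = a / c by rewrite acosK// in_itv.
rewrite /carg -/a -/b -/c; case: ifPn => b0.
  by rewrite cE sE ger0_norm// divr_ge0// ltW.
rewrite cosN sinN cE sE.
split=> //; rewrite ler0_norm ?opprK// ?pmulr_lle0 ?invr_gt0//.
by rewrite ltW// ltNge.
Qed.

Lemma carg_bound z : z != 0 -> `|carg z| <= pi.
Proof.
move=> z0; have c0 := cmod_gt0 z0; have cs := cmod_sqr z.
have h1 : -1 <= complex.Re z / cmod z <= 1.
  rewrite -ler_norml normrM normfV (gtr0_norm c0) ler_pdivrMr// mul1r.
  rewrite -(@ler_pXn2r _ 2) ?nnegrE ?cmod_ge0// cs real_normK ?num_real//.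
  by rewrite lerDl sqr_ge0.
have h2 : `|acos (complex.Re z / cmod z)| <= pi.
  by rewrite ger0_norm ?acos_ge0 ?acos_lepi.
by rewrite /carg; case: ifP => _; rewrite ?normrN.
Qed.

Lemma cpow0 z : cpow z 0 = 1.
Proof.
by rewrite /cpow eqxx; case: ifP => // _; rewrite powRr0 !mul0r cos0 sin0 mulr1 mulr0.
Qed.

Lemma cpow1 z : cpow z 1 = z.
Proof.
rewrite /cpow oner_eq0; case: eqVneq => [->//|z0].
have [hc hs] := cos_sin_carg z0; rewrite !mul1r hc hs.
have c0 := cmod_gt0 z0.
rewrite powRr1 ?ltW// !(mulrC (cmod z)) !mulfVK ?gt_eqF//.
by case: (z).
Qed.

Lemma cpow_real r a : 0 <= r -> cpow r%:C a = (r `^ a)%:C.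
Proof.
rewrite le_eqVlt => /predU1P[<-|r0].
  rewrite /cpow eqxx; case: eqVneq => [->|a0]; first by rewrite powRr0.
  by rewrite powR0.
have rn0 : r%:C != 0 :> R[i] by rewrite -cmod_eq0 cmod_real ?(ltW r0)// gt_eqF.
rewrite /cpow (negPf rn0) /carg /= lexx cmod_real ?(ltW r0)// divff ?gt_eqF//.
by rewrite acos1 mulr0 cos0 sin0 mulr1 mulr0.
Qed.

Lemma cmod_cpow z a : cmod (cpow z a) = cmod z `^ a.
Proof.
rewrite /cpow; case: eqVneq => [->|z0].
  rewrite cmod0; case: eqVneq => [->|a0]; last by rewrite powR0// cmod0.
  by rewrite powRr0 (@cmod_real 1).
rewrite {1}/cmod /= !exprMn -mulrDr cos2Dsin2 mulr1 sqrtr_sqr ger0_norm//.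
exact: powR_ge0.
Qed.

(* For [0 < a < 1] the principal branch of [z ^ a] has argument in *)
(* [(- pi, pi)], so it can only be real nonnegative if [z] is. *)
Lemma cpow_ge0_inv z a : 0 < a < 1 -> 0 <= cpow z a -> z = (complex.Re z)%:C /\ 0 <= complex.Re z.
Proof.
move=> /andP[a0 a1]; rewrite /cpow; case: eqVneq => [->//|z0].
rewrite lecE /= => /andP[/eqP hs hc].
have c0 := cmod_gt0 z0.
have ca : carg z = 0.
  have p0 : 0 < cmod z `^ a by rewrite powR_gt0.
  move/eqP: hs; rewrite mulf_eq0 (gt_eqF p0) /= => /eqP hs.
  apply/eqP/negPn/negP => cn0.
  have : 0 < sin (a * `|carg z|).
    apply: sin_gt0_pi; rewrite mulr_gt0 ?normr_gt0//=.
    apply: le_lt_trans (_ : a * pi < _); first by rewrite ler_wpM2l ?carg_bound// ltW.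
    by rewrite gtr_pMl// pi_gt0.
  have [h|h] := ger0P (carg z); first by rewrite hs ltxx.
  by rewrite mulrN sinN hs oppr0 ltxx.
have [] := cos_sin_carg z0; rewrite ca cos0 sin0 => h1 h2.
have rE : complex.Re z = cmod z by rewrite -[RHS]mul1r h1 mulfVK ?gt_eqF.
have iE : complex.Im z = 0.
  by apply/eqP; move/esym/eqP: h2; rewrite mulf_eq0 invr_eq0 (gt_eqF c0) orbF.
rewrite rE; split; last exact: ltW.
by apply/eqP; rewrite eq_complex /= rE iE !eqxx.
Qed.

End ComplexPower.

(** * Iterated integrals over counting measures *)

Section IteratedSum.
Context {J : finType}.
Local Open Scope classical_set_scope.

(** Finite counterpart of [iint_seq]: every coordinate runs over 0, ..., N - 1. The values lie in
    any [K], so real and complex integrands share one theory. *)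
Fixpoint isum {K : nmodType} (N : nat) (s : seq J) (g : (J -> nat) -> K)
    (x : J -> nat) : K :=
  match s with
  | [::] => g x
  | j :: s' => \sum_(i < N) isum N s' g (upd x j (i : nat))
  end.

Lemma eq_isum (K : nmodType) N s (g h : (J -> nat) -> K) x :
  (forall y, g y = h y) -> isum N s g x = isum N s h x.
Proof. by move=> gh; congr (isum _ _ _ _); apply: funext. Qed.

Lemma isum_raddf (K L : nmodType) (phi : {additive K -> L}) N s (g : (J -> nat) -> K) x :
  phi (isum N s g x) = isum N s (fun y => phi (g y)) x.
Proof. by elim: s x => //= j s IH x; rewrite raddf_sum; apply: eq_bigr. Qed.

Lemma isumD (K : nmodType) N s (g h : (J -> nat) -> K) x :
  isum N s (fun y => g y + h y) x = isum N s g x + isum N s h x.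
Proof. by elim: s x => //= j s IH x; rewrite -big_split; apply: eq_bigr. Qed.

Lemma isum_bigsum (K : nmodType) (I : finType) N s (g : I -> (J -> nat) -> K) x :
  isum N s (fun y => \sum_i g i y) x = \sum_i isum N s (g i) x.
Proof.
elim: s x => //= j s IH x.
by rewrite exchange_big; apply: eq_bigr => i _; rewrite IH.
Qed.

Lemma isumZ (K : pzSemiRingType) N s (c : K) (g : (J -> nat) -> K) x :
  isum N s (fun y => c * g y) x = c * isum N s g x.
Proof. by elim: s x => //= j s IH x; rewrite mulr_sumr; apply: eq_bigr. Qed.

Lemma isumN (K : zmodType) N s (g : (J -> nat) -> K) x :
  isum N s (fun y => - g y) x = - isum N s g x.
Proof. by elim: s x => //= j s IH x; rewrite -sumrN; apply: eq_bigr. Qed.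

Lemma ler_isum (K : numDomainType) N s (g h : (J -> nat) -> K) x :
  (forall y, g y <= h y) -> isum N s g x <= isum N s h x.
Proof. by move=> gh; elim: s x => //= j s IH x; apply: ler_sum. Qed.

Lemma isum_ge0 (K : numDomainType) N s (g : (J -> nat) -> K) x :
  (forall y, 0 <= g y) -> 0 <= isum N s g x.
Proof. by move=> g0; elim: s x => //= j s IH x; apply: sumr_ge0. Qed.

Lemma ler_norm_isum (K : numDomainType) N s (g : (J -> nat) -> K) x :
  `|isum N s g x| <= isum N s (fun y => `|g y|) x.
Proof.
elim: s x => //= j s IH x.
by apply: le_trans (ler_norm_sum _ _ _) _; apply: ler_sum.
Qed.

Lemma isum_nondecreasing (K : numDomainType) N M s (g : (J -> nat) -> K) x :
  (forall y, 0 <= g y) -> (N <= M)%N -> isum N s g x <= isum M s g x.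
Proof.
move=> g0 NM; elim: s x => //= j s IH x.
rewrite -!(big_mkord xpredT (fun i => isum _ s g (upd x j i))).
rewrite (@big_cat_nat _ _ _ N 0 M)//= -[leLHS]addr0; apply: lerD; first exact: ler_sum.
by apply: sumr_ge0 => i _; exact: isum_ge0.
Qed.

Lemma big_ord_divn_modn (K : nmodType) (M N : nat) (h : nat -> nat -> K) :
  \sum_(i < M * N) h (i %/ N)%N (i %% N)%N = \sum_(a < M) \sum_(b < N) h a b.
Proof.
case: N => [|N]; first by rewrite muln0 big_ord0 big1// => a _; rewrite big_ord0.
rewrite -(big_mkord xpredT (fun i => h (i %/ N.+1)%N (i %% N.+1)%N)) big_nat_mul.
rewrite big_mkord; apply: eq_bigr => a _.
rewrite mulSn -{1}[(a * _)%N]add0n big_addn addnK big_mkord; apply: eq_bigr => b _.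
by rewrite addnC divnMDl// modnMDl divn_small// modn_small// addn0.
Qed.

(** Quotient and remainder by [N] identify the [N * N] points with pairs of points, so the sum of a
    product of separate variables factors. *)
Lemma isum_tensor (K : comPzSemiRingType) N s (g h : (J -> nat) -> K) x :
  isum (N * N) s (fun y => g (fun j => y j %/ N)%N * h (fun j => y j %% N)%N) x =
  isum N s g (fun j => x j %/ N)%N * isum N s h (fun j => x j %% N)%N.
Proof.
elim: s x => //= j s IH x; rewrite mulr_suml.
under [RHS]eq_bigr do rewrite mulr_sumr.
rewrite -[RHS](@big_ord_divn_modn K N N (fun a b => isum N s g (upd (fun j => x j %/ N)%N j a) *
  isum N s h (upd (fun j => x j %% N)%N j b))).
apply: eq_bigr => i _; rewrite IH; congr (isum _ _ _ _ * isum _ _ _ _);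
  by apply: funext => j'; rewrite /upd; case: ifP.
Qed.

End IteratedSum.

Section CountingIntegral.
Context {R : realType} {J : finType}.
Local Open Scope classical_set_scope.

(** The counting measure of {0, ..., N - 1}. *)
Definition mdiracs (N : nat) : {measure set nat -> \bar R} :=
  msum (fun n : nat => (\d_n : {measure set nat -> \bar R})) N.

Lemma integral_mdiracs N (g : nat -> \bar R) : (forall n, 0 <= g n)%E ->
  (\int[mdiracs N]_(y in setT) g y = \sum_(i < N) g i)%E.
Proof.
move=> g0; rewrite ge0_integral_measure_sum//; apply: eq_bigr => i _.
by rewrite integral_dirac// diracE in_setT mul1e.
Qed.

Lemma sigma_finite_mdiracs N : sigma_finite [set: nat] (mdiracs N).
Proof.
exists (fun _ => setT); first by rewrite bigcup_const.
move=> _; split => //; rewrite /= /msum lte_sum_pinfty// => i _.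
exact: ltry.
Qed.

Lemma iint_seq_mdiracs N (s : seq J) (g : (J -> nat) -> R) x : (forall y, 0 <= g y) ->
  iint_seq (mdiracs N) s (fun y => (g y)%:E) x = (isum N s g x)%:E.
Proof.
move=> g0; elim: s x => //= j s IH x; under eq_integral do rewrite IH.
by rewrite integral_mdiracs ?sumEFin// => n; rewrite lee_fin isum_ge0.
Qed.

(** Monotone convergence for all coordinates truncated at the same [N], by induction on the list of
    coordinates. Nonnegativity is carried along because the next integral is evaluated as a series
    of nonnegative terms. *)
Lemma iint_seq_counting_cvg (s : seq J) (g : (J -> nat) -> R) x : (forall y, 0 <= g y) ->
  (isum N s g x)%:E @[N --> \oo] --> iint_seq (@counting nat R) s (fun y => (g y)%:E) x
  /\ (0 <= iint_seq (@counting nat R) s (fun y => (g y)%:E) x)%E.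
Proof.
move=> g0; elim: s x => [|j s IH] x /=.
  by split; [exact: cvg_cst | rewrite lee_fin].
set H := fun k => iint_seq (@counting nat R) s (fun y => (g y)%:E) (upd x j k).
have H0 k : (0 <= H k)%E by case: (IH (upd x j k)).
have hH k : (isum N s g (upd x j k))%:E @[N --> \oo] --> H k by case: (IH (upd x j k)).
have nd k : nondecreasing_seq (fun N => (isum N s g (upd x j k))%:E).
  by move=> N M NM; rewrite lee_fin isum_nondecreasing.
have hle N k : ((isum N s g (upd x j k))%:E <= H k)%E.
  rewrite (cvg_unique (@ereal_hausdorff R) (hH k) (ereal_nondecreasing_cvgn (nd k))).
  by apply: ereal_sup_ubound; exists N.
rewrite ge0_integral_count//; split; last by apply: nneseries_ge0 => k _ _; exact: H0.
set a := fun N : nat => (\sum_(i < N) isum N s g (upd x j i))%:E.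
have nda : nondecreasing_seq a.
  by move=> N M NM; rewrite lee_fin; exact: (@isum_nondecreasing _ _ N M (j :: s)).
have := ereal_nondecreasing_cvgn nda.
suff -> : \big[+%E/0%R]_(0 <= k <oo) H k = ereal_sup (range a) by [].
apply/eqP; rewrite eq_le; apply/andP; split; last first.
  apply: ge_ereal_sup => _ [N _ <-]; rewrite /a -sumEFin.
  apply: (@le_trans _ _ (\sum_(0 <= k < N) H k)%E).
    by rewrite big_mkord; apply: lee_sum => i _.
  exact: nneseries_lim_ge.
apply: lime_le; first exact: is_cvg_nneseries.
(* For fixed [M], the partial sum of the inner limits is a limit in [N] of partial sums, each of
   which is at most [a N] once [M <= N]. *)
apply: nearW => M.
have : (\sum_(0 <= k < M) (isum N s g (upd x j k))%:E)%E @[N --> \oo]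
    --> (\sum_(0 <= k < M) H k)%E.
  by apply: cvg_nnesum => // k _; apply: nearW => N; rewrite lee_fin isum_ge0.
move=> cv; rewrite -(cvg_lim (@ereal_hausdorff R) cv).
apply: lime_le; first by apply/cvg_ex; eexists; exact: cv.
exists M => // N /= MN; apply: (@le_trans _ _ (a N)); last first.
  by apply: ereal_sup_ubound; exists N.
rewrite /a sumEFin lee_fin -(big_mkord xpredT (fun i => isum N s g (upd x j i))).
rewrite (@big_cat_nat _ _ _ M 0 N)//= lerDl; apply: sumr_ge0 => i _; exact: isum_ge0.
Unshelve. all: by end_near.
Qed.

Lemma iint_counting_cvg (g : (J -> nat) -> R) : (forall y, 0 <= g y) ->
  iint (mdiracs N) (fun y => (g y)%:E) @[N --> \oo]
    --> iint (@counting nat R) (fun y => (g y)%:E).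
Proof.
move=> g0; have [h _] := iint_seq_counting_cvg (enum J) (fun=> point) g0.
by under eq_fun do rewrite /iint iint_seq_mdiracs//.
Qed.

Lemma le_iint_counting (g h : (J -> nat) -> R) :
  (forall y, 0 <= g y) -> (forall y, g y <= h y) ->
  (iint (@counting nat R) (fun y => (g y)%:E) <= iint (@counting nat R) (fun y => (h y)%:E))%E.
Proof.
move=> g0 gh; have h0 y : 0 <= h y := le_trans (g0 y) (gh y).
have cg := iint_counting_cvg g0; have ch := iint_counting_cvg h0.
rewrite -(cvg_lim (@ereal_hausdorff R) cg) -(cvg_lim (@ereal_hausdorff R) ch).
apply: lee_lim; [by apply/cvg_ex; eexists; exact: cg|by apply/cvg_ex; eexists; exact: ch|].
by apply: nearW => N; rewrite /iint !iint_seq_mdiracs// lee_fin ler_isum.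
Qed.

Lemma iint_counting_ge0 (g : (J -> nat) -> R) : (forall y, 0 <= g y) ->
  (0 <= iint (@counting nat R) (fun y => (g y)%:E))%E.
Proof. by move=> g0; have [] := iint_seq_counting_cvg (enum J) (fun=> point) g0. Qed.

Lemma rint_mdiracs N (g : (J -> nat) -> R) :
  rint (mdiracs N) g = isum N (enum J) g (fun=> point).
Proof.
rewrite /rint /iint !iint_seq_mdiracs//; last 2 first.
- by move=> y; rewrite le_max lexx orbT.
- by move=> y; rewrite le_max lexx orbT.
rewrite /= -isumN -isumD; apply: eq_isum => y.
by rewrite maxEle maxEle; case: ifPn; case: ifPn; lra.
Qed.

(** Positive and negative parts converge separately; the majorant [h] makes their limits finite, so
    that [fine] is continuous there. *)
Lemma rint_counting_cvg (g h : (J -> nat) -> R) : (forall y, `|g y| <= h y) ->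
  (iint (@counting nat R) (fun y => (h y)%:E) < +oo)%E ->
  rint (mdiracs N) g @[N --> \oo] --> rint (@counting nat R) g.
Proof.
move=> gh hoo.
have part (g' : (J -> nat) -> R) : (forall y, 0 <= g' y) -> (forall y, g' y <= h y) ->
    fine (iint (mdiracs N) (fun y => (g' y)%:E)) @[N --> \oo] -->
    fine (iint (@counting nat R) (fun y => (g' y)%:E)).
  move=> g0 g'h; apply: fine_cvg; rewrite fineK; first exact: iint_counting_cvg.
  rewrite ge0_fin_numE ?iint_counting_ge0//.
  by apply: le_lt_trans hoo; exact: le_iint_counting.
have h0 y : 0 <= h y by rewrite (le_trans _ (gh y)).
by apply: cvgB; apply: part => y; rewrite ?le_max ?ge_max ?lexx ?orbT ?h0 ?andbT//;
  apply: le_trans (gh y); rewrite ?ler_norm// -normrN ler_norm.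
Qed.

Lemma Re_isum N s (g : (J -> nat) -> R[i]) x :
  complex.Re (isum N s g x) = isum N s (fun y => complex.Re (g y)) x.
Proof.
elim: s x => //= j s IH x.
rewrite (big_morph (@complex.Re R) (id1 := 0) (op1 := +%R))//; last by do 2!case=> ? ?.
exact: eq_bigr.
Qed.

Lemma Im_isum N s (g : (J -> nat) -> R[i]) x :
  complex.Im (isum N s g x) = isum N s (fun y => complex.Im (g y)) x.
Proof.
elim: s x => //= j s IH x.
rewrite (big_morph (@complex.Im R) (id1 := 0) (op1 := +%R))//; last by do 2!case=> ? ?.
exact: eq_bigr.
Qed.

Lemma cint_mdiracs N (g : (J -> nat) -> R[i]) :
  cint (mdiracs N) g = isum N (enum J) g (fun=> point).
Proof.
by rewrite /cint !rint_mdiracs -Re_isum -Im_isum; case: (isum _ _ _ _).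
Qed.

(** Every set of tuples is a countable union of measurable singletons. Hence membership in [inLH]
    reduces to finiteness of the integral. *)
Lemma measurable_tuple_nat k (A : set (k.-tuple nat)) : measurable A.
Proof.
have -> : A = \bigcup_t (A `&` [set t]).
  by apply/seteqP; split => [t At|t [u _ []]]//; exists t.
apply: countable_bigcupT_measurable => [|t]; first exact: countableP.
have [At|nAt] := pselect (A t); last first.
  by rewrite (_ : _ `&` _ = set0)//; apply/seteqP; split => // x [Ax xt]; rewrite -xt in nAt.
rewrite (_ : _ `&` _ = [set t]); last first.
  by apply/seteqP; split => [x []//|_ ->].
have -> : [set t] = \bigcap_(i in [set: 'I_k])
    ((fun x : k.-tuple nat => tnth x i) @^-1` [set tnth t i]).
  apply/seteqP; split => [_ -> //|x hx]; apply: eq_from_tnth => i; exact: hx.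
apply: fin_bigcap_measurable => // i _.
rewrite -[X in measurable X]setTI; exact: measurable_tnth.
Qed.

Lemma cmeasurable_nat k (f : k.-tuple nat -> R[i]) : cmeasurable f.
Proof. by split => _ B _; exact: measurable_tuple_nat. Qed.

End CountingIntegral.

(** * Multilinear forms over the edges *)

Section MultilinearForm.
Context {k : nat} {n : 'I_k -> nat} {m : nat} (e : 'I_m -> Vt k n).
Local Notation point0 := (fun=> point : nat).

(** The polarised integral of f^H over the [N]-point space: each edge carries its own function. *)
Definition form {K : comPzSemiRingType} (N : nat) (F : 'I_m -> k.-tuple nat -> K) : K :=
  isum N (enum {: Jt k n}) (fun x => \prod_(i < m) F i (hproj (e i) x)) point0.

(** Tensor product of [f] and [g], with pairs of points coded by quotient and remainder. *)
Definition tens {K : comPzSemiRingType} (N : nat) (f g : k.-tuple nat -> K)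
    (t : k.-tuple nat) : K :=
  f (map_tuple (divn^~ N) t) * g (map_tuple (modn^~ N) t).

Lemma hproj_comp (h : nat -> nat) w (x : Jt k n -> nat) :
  hproj w (fun j => h (x j)) = map_tuple h (hproj w x).
Proof. by apply: eq_from_tnth => i; rewrite [RHS]tnth_map !tnth_mktuple. Qed.

Lemma eq_form (K : comPzSemiRingType) {N} (F G : 'I_m -> k.-tuple nat -> K) :
  (forall i t, F i t = G i t) -> form N F = form N G.
Proof. by move=> FG; apply: eq_isum => x; apply: eq_bigr => i _. Qed.

Lemma form_tens (K : comPzSemiRingType) N (F G : 'I_m -> k.-tuple nat -> K) :
  form (N * N) (fun i => tens N (F i) (G i)) = form N F * form N G.
Proof.
have tensE (g h : (Jt k n -> nat) -> K) (x x1 x2 : Jt k n -> nat) :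
    (forall j, x1 j = x j %/ N)%N -> (forall j, x2 j = x j %% N)%N ->
    isum N (enum {: Jt k n}) g x1 * isum N (enum {: Jt k n}) h x2 =
    isum (N * N) (enum {: Jt k n}) (fun y => g (fun j => y j %/ N)%N * h (fun j => y j %% N)%N) x.
  by move=> /funext -> /funext ->; rewrite isum_tensor.
rewrite /form (tensE _ _ point0) => [|j|j]; rewrite ?div0n ?mod0n//.
apply: eq_isum => x.
by rewrite -big_split; apply: eq_bigr => i _; rewrite /tens -!hproj_comp.
Qed.

Lemma form_sum (K : comPzSemiRingType) (I : finType) N (F : 'I_m -> I -> k.-tuple nat -> K) :
  form N (fun i t => \sum_l F i l t) =
  \sum_(phi : {ffun 'I_m -> I}) form N (fun i => F i (phi i)).
Proof.
rewrite /form -isum_bigsum; apply: eq_isum => x.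
by rewrite bigA_distr_bigA.
Qed.

Lemma formZ (K : comPzSemiRingType) N (c : 'I_m -> K) (F : 'I_m -> k.-tuple nat -> K) :
  form N (fun i t => c i * F i t) = (\prod_i c i) * form N F.
Proof. by rewrite /form -isumZ; apply: eq_isum => x; rewrite big_split. Qed.

Lemma ler_form (K : numDomainType) N (F G : 'I_m -> k.-tuple nat -> K) :
  (forall i t, 0 <= F i t <= G i t) -> form N F <= form N G.
Proof. by move=> FG; apply: ler_isum => x; apply: ler_prod => i _. Qed.

Lemma form_ge0 (K : numDomainType) N (F : 'I_m -> k.-tuple nat -> K) :
  (forall i t, 0 <= F i t) -> 0 <= form N F.
Proof. by move=> F0; apply: isum_ge0 => x; apply: prodr_ge0. Qed.

Lemma ler_norm_form (K : numDomainType) N (F : 'I_m -> k.-tuple nat -> K) :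
  `|form N F| <= form N (fun i t => `|F i t|).
Proof.
apply: le_trans (ler_norm_isum _ _ _ _) _.
by apply: ler_isum => x; rewrite normr_prod.
Qed.

Definition pick2 {K : comPzSemiRingType} (P L : 'I_m -> k.-tuple nat -> K)
    (phi : {ffun 'I_m -> bool}) (i : 'I_m) : k.-tuple nat -> K :=
  if phi i then L i else P i.

Lemma form_comb2 (K : comPzSemiRingType) N (P L : 'I_m -> k.-tuple nat -> K) (p l : K) :
  form N (fun i t => p * P i t + l * L i t) =
  \sum_(phi : {ffun 'I_m -> bool}) (\prod_i (if phi i then l else p)) * form N (pick2 P L phi).
Proof.
rewrite -(eq_form (F := fun i t =>
  \sum_(b : bool) (if b then l else p) * (if b then L i else P i) t)).
  rewrite form_sum; apply: eq_bigr => phi _; rewrite -formZ.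
  by apply: eq_form => i t; rewrite /pick2; case: (phi i).
by move=> i t; rewrite big_bool addrC.
Qed.

Lemma prod_comb2 (K : comPzSemiRingType) (p l : K) :
  \sum_(phi : {ffun 'I_m -> bool}) \prod_i (if phi i then l else p) = (p + l) ^+ m.
Proof.
rewrite -(bigA_distr_bigA (fun _ (b : bool) => if b then l else p)).
by under eq_bigr do rewrite big_bool /= addrC; rewrite prodr_const card_ord.
Qed.

(** Expand over all choices of [P] or [L] on each edge; the coefficients add up to
    [(p + l) ^+ m]. *)
Lemma form_comb_le (K : numDomainType) N (P L : 'I_m -> k.-tuple nat -> K) (p l : K) :
  0 <= p -> 0 <= l -> (forall phi, `|form N (pick2 P L phi)| <= 1) ->
  `|form N (fun i t => p * P i t + l * L i t)| <= (p + l) ^+ m.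
Proof.
move=> p0 l0 h; rewrite form_comb2 -prod_comb2.
apply: le_trans (ler_norm_sum _ _ _) _; apply: ler_sum => phi _.
have A0 : 0 <= \prod_i (if phi i then l else p) by apply: prodr_ge0 => i _; case: ifP.
by rewrite normrM ger0_norm// ler_piMr.
Qed.

(* Only the terms with an even number of factors [L] survive in the sum. *)
Lemma form_even_le (K : numDomainType) N (P L : 'I_m -> k.-tuple nat -> K) (p l : K) :
  0 <= p -> 0 <= l -> (forall phi, `|form N (pick2 P L phi)| <= 1) ->
  `|form N (fun i t => p * P i t + l * L i t) + form N (fun i t => p * P i t - l * L i t)|
    <= (p + l) ^+ m + (p - l) ^+ m.
Proof.
move=> p0 l0 h.
rewrite (eq_form (F := fun i t => p * P i t - l * L i t)
  (G := fun i t => p * P i t + (- l) * L i t)).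
  rewrite !form_comb2 -!prod_comb2 -!big_split /=.
  apply: le_trans (ler_norm_sum _ _ _) _; apply: ler_sum => phi _.
  rewrite -mulrDl normrM.
  set A := \prod_i (if phi i then l else p); set B := \prod_i _.
  have A0 : 0 <= A by apply: prodr_ge0 => i _; case: ifP.
  (* The sign counts the edges carrying [L], so [A + B] is either [2 * A] or 0, in particular
     nonnegative. *)
  have BE : B = (-1) ^+ (\sum_i (phi i : nat)) * A.
    rewrite /A /B -prodrXr -big_split; apply: eq_bigr => i _.
    by case: (phi i); rewrite /= ?expr1 ?mulN1r ?expr0 ?mul1r.
  have AB : 0 <= A + B.
    rewrite BE -signr_odd; case: odd; first by rewrite expr1 mulN1r subrr.
    by rewrite expr0 mul1r addr_ge0.
  by rewrite ger0_norm// ler_piMr.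
by move=> i t; rewrite mulNr.
Qed.

End MultilinearForm.

(** * Bounded powers and products over the edges *)

Section Scalar.
Context {R : realType}.
Implicit Types (c K : R).

(** The last step of the tensor power trick: by Bernoulli, the powers of a number above 1 are
    unbounded. *)
Lemma le1_of_pow_bounded c K : 0 <= c -> (forall j, c ^+ (2 ^ j) <= K) -> c <= 1.
Proof.
move=> c0 h; rewrite leNgt; apply/negP => c1.
have d0 : 0 < c - 1 by lra.
have K0 : 0 <= K := le_trans (exprn_ge0 _ c0) (h 0).
pose j := Num.bound (K / (c - 1)).
have : K / (c - 1) < j%:R by rewrite archi_boundP// divr_ge0// ltW.
rewrite ltr_pdivrMr// => hK.
have h1 : 1 <= (2 ^ j)%:R :> R by rewrite ler1n expn_gt0.
have := powR_convex_at1 h1 c0; rewrite powR_mulrn// => h2.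
have h3 : j%:R <= (2 ^ j)%:R :> R by rewrite ler_nat ltnW// ltn_expl.
have := h j; have := ler_wpM2r (ltW d0) h3; lra.
Qed.

(** Let [i0] maximise [r]. The factor [1 - c * r i0] of this one edge already bounds the product of
    the [X i], while the product of the [Y i] gains (r i0) ^ (kappa * m), which is at most [r i0]
    because [1 <= kappa * m]. *)
Lemma prod_tradeoff (m : nat) (X Y B r : 'I_m -> R) (c kappa : R) :
  (0 < m)%N -> 0 < c <= 1 -> 0 <= kappa -> 1 <= kappa * m%:R ->
  (forall i, [/\ 0 <= X i, 0 <= Y i & 0 <= B i]) ->
  (forall i, [/\ 0 <= r i <= 1, X i <= (1 - c * r i) * B i & Y i <= r i `^ kappa * B i]) ->
  \prod_i X i + c * \prod_i Y i <= \prod_i B i.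
Proof.
move=> m0 /andP[c0 c1] k0 km pos h.
pose i1 := Ordinal m0.
pose i0 := [arg max_(i > i1) r i]%O.
have rmax i : r i <= r i0 by rewrite /i0; case: arg_maxP => // j _ /(_ i); exact.
have r01 i : 0 <= r i <= 1 by case: (h i).
have PB : 0 <= \prod_i B i by apply: prodr_ge0 => i _; case: (pos i).
have f01 i : 0 <= 1 - c * r i <= 1.
  have /andP[a b] := r01 i; have := mulr_ge0 (ltW c0) a.
  have : c * r i <= 1 * 1 by apply: ler_pM => //; exact: ltW.
  lra.
have hX : \prod_i X i <= (1 - c * r i0) * \prod_i B i.
  apply: (@le_trans _ _ (\prod_i ((1 - c * r i) * B i))).
    by apply: ler_prod => i _; have [] := h i; have [-> _ _ _ ->] := pos i.
  rewrite big_split /= ler_wpM2r// (bigD1 i0)//= ler_piMr//; first by case/andP: (f01 i0).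
  by apply: prodr_ile1 => i _.
have hY : \prod_i Y i <= r i0 * \prod_i B i.
  apply: (@le_trans _ _ (\prod_i ((r i0 `^ kappa) * B i))).
    apply: ler_prod => i _; have [_ _ hy] := h i; have [_ -> b0] := pos i.
    apply: le_trans hy _; apply: ler_wpM2r => //.
    by apply: ler_powRl => //; case/andP: (r01 i).
  rewrite big_split /= ler_wpM2r// prodr_const card_ord -powR_mulrn ?powR_ge0// -powRrM.
  have /andP[a b] := r01 i0.
  have [->|rn0] := eqVneq (r i0) 0.
    by rewrite powR0// gt_eqF//; lra.
  by apply: ge1r_powR => //; rewrite lt_neqAle eq_sym rn0 a.
have := ler_wpM2l (ltW c0) hY; lra.
Qed.

End Scalar.

(** * Tensor power trick and Hoelder-type inequalities *)

Section HomDensityFacts.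
Context {R : realType} {k : nat} {n : 'I_k -> nat} (alpha beta : Vt k n -> R).
Local Open Scope complex_scope.
Implicit Types f g : k.-tuple nat -> R[i].

Lemma fH_cmod f x : fH alpha beta (fun t => (cmod (f t))%:C) x = (cmod (fH alpha beta f x))%:C.
Proof.
rewrite -normcE_cmod normr_prod; apply: eq_bigr => w _.
rewrite !cpow_real ?cmod_ge0// normrM !normcE_cmod cmodJ !cmod_cpow; congr (_ * _).
exact: conjc_real.
Qed.

Lemma inLH_mdiracs N f : inLH alpha beta (mdiracs N) f.
Proof.
split; first exact: cmeasurable_nat.
under [X in iint _ X]eq_fun do rewrite fH_cmod.
by rewrite /iint iint_seq_mdiracs ?ltry// => y; exact: cmod_ge0.
Qed.

Definition supp_set : {set Vt k n} := [set w | (alpha w != 0) || (beta w != 0)].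

Definition edge (i : 'I_#|supp_set|) : Vt k n := enum_val i.

Lemma edge_supp i : supp_ab alpha beta (edge i).
Proof. by have := enum_valP i; rewrite inE => /orP. Qed.

Lemma big_edge (K : Type) (idx : K) (op : Monoid.com_law idx) (F : Vt k n -> K) :
  (forall w, alpha w = 0 -> beta w = 0 -> F w = idx) ->
  \big[op/idx]_w F w = \big[op/idx]_(i < #|supp_set|) F (edge i).
Proof.
move=> F1; rewrite /edge -(big_enum_val F) /= [RHS]big_mkcond.
apply: eq_bigr => w _; rewrite inE; case: eqVneq => //= a0; case: eqVneq => //= b0.
exact: F1.
Qed.

Lemma fH_edge f x : fH alpha beta f x =
  \prod_(i < #|supp_set|) (cpow (f (hproj (edge i) x)) (alpha (edge i)) *
                           Num.conj (cpow (f (hproj (edge i) x)) (beta (edge i)))).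
Proof.
apply: (@big_edge _ _ _ (fun w =>
  cpow (f (hproj w x)) (alpha w) * Num.conj (cpow (f (hproj w x)) (beta w)))).
by move=> w -> ->; rewrite cpow0 mul1r; exact: conjc1.
Qed.

Lemma hsize_edge : hsize alpha beta =
  \sum_(i < #|supp_set|) (`|alpha (edge i)| + `|beta (edge i)|).
Proof. by apply: (@big_edge _ _ _ (fun w => _ + _)) => w -> ->; rewrite normr0 addr0. Qed.

Section TypeI.
Variable s : R.
Hypothesis hI : typeI alpha beta s.

Lemma hsize_typeI : hsize alpha beta = s * #|supp_set|%:R.
Proof.
have [s1 h] := hI.
rewrite hsize_edge (eq_bigr (fun=> s)); first by rewrite sumr_const card_ord mulr_natr.
move=> i _; have [-> ->] := h _ (edge_supp i).
by rewrite ger0_norm -?splitr// divr_ge0//; lra.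
Qed.

(** On each edge, z ^ (s / 2) times its conjugate is the squared modulus of z ^ (s / 2), namely |z|
    ^ s. *)
Lemma fH_typeI f x : fH alpha beta f x =
  (\prod_(i < #|supp_set|) cmod (f (hproj (edge i) x)) `^ s)%:C.
Proof.
have [s1 h] := hI.
rewrite fH_edge rmorph_prod; apply: eq_bigr => i _.
have [-> ->] := h _ (edge_supp i).
rewrite mulcJ_cmod cmod_cpow -powR_mulrn ?powR_ge0// -powRrM.
by congr ((_ `^ _)%:C); field.
Qed.
End TypeI.

Section TypeII.
Hypothesis hII : typeII alpha beta.

Lemma hsize_typeII : hsize alpha beta = #|supp_set|%:R.
Proof.
rewrite hsize_edge (eq_bigr (fun=> 1)); first by rewrite sumr_const card_ord.
by move=> i _; have [[-> ->]|[-> ->]] := hII (edge_supp i); rewrite normr0 normr1 ?addr0 ?add0r.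
Qed.

Definition twist (i : 'I_#|supp_set|) (z : R[i]) : R[i] :=
  if beta (edge i) == 0 then z else Num.conj z.

Lemma fH_typeII f x : fH alpha beta f x =
  \prod_(i < #|supp_set|) twist i (f (hproj (edge i) x)).
Proof.
rewrite fH_edge; apply: eq_bigr => i _; rewrite /twist.
have [[-> ->]|[-> ->]] := hII (edge_supp i).
  by rewrite oner_eq0 cpow0 cpow1 mul1r.
by rewrite eqxx cpow0 cpow1 (conjc1 R : Num.conj 1 = 1) mulr1.
Qed.
End TypeII.

End HomDensityFacts.

Section SemiNorming.
Context {R : realType} {k : nat} {n : 'I_k -> nat} (alpha beta : Vt k n -> R).
Local Open Scope complex_scope.
Implicit Types f g : k.-tuple nat -> R[i].
Hypothesis sn : semi_norming alpha beta.
Hypothesis hq : 2 <= hsize alpha beta.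
Local Notation q := (hsize alpha beta).

Let q_gt0 : 0 < q := lt_le_trans (ltr0n R 2) hq.
Let q_gt1 : 1 < q := lt_le_trans (ltr1n R 2) hq.

Definition nuH (mu : {measure set nat -> \bar R}) f : R := complex.Re (normH alpha beta mu f).

Section AnyMeasure.
Variable mu : {measure set nat -> \bar R}.
Hypothesis smu : sigma_finite [set: nat] mu.

Lemma seminorm_mu : seminorm_on_LH alpha beta mu.
Proof. by have [_ [_ h]] := sn; exact: h. Qed.

Lemma normH_nuH f : inLH alpha beta mu f -> normH alpha beta mu f = (nuH mu f)%:C /\ 0 <= nuH mu f.
Proof.
move=> Lf; have [_ _ h _ _] := seminorm_mu; have := h _ Lf.
rewrite /nuH; case: (normH _ _ _ _) => a b; rewrite lecE /= => /andP[/eqP -> a0].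
by split.
Qed.

(** The semi-norm axioms make only the root of order [q] of the integral nonnegative. As [q > 1],
    [cpow_ge0_inv] transfers this to the integral itself. *)
Lemma cint_nuH f : inLH alpha beta mu f ->
  cint mu (fH alpha beta f) = (nuH mu f `^ q)%:C /\
  nuH mu f = complex.Re (cint mu (fH alpha beta f)) `^ q^-1.
Proof.
move=> Lf; have [_ _ h _ _] := seminorm_mu; have := h _ Lf.
have q01 : 0 < q^-1 < 1 by rewrite invr_gt0 q_gt0 invf_lt1.
move=> /(cpow_ge0_inv q01)[zE z0].
have nE : nuH mu f = complex.Re (cint mu (fH alpha beta f)) `^ q^-1.
  by rewrite /nuH /normH zE cpow_real.
by split => //; rewrite nE -powRrM mulVf ?gt_eqF// powRr1.
Qed.

Lemma nuH_D f g : inLH alpha beta mu f -> inLH alpha beta mu g ->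
  inLH alpha beta mu (fun t => f t + g t) /\
  nuH mu (fun t => f t + g t) <= nuH mu f + nuH mu g.
Proof.
move=> Lf Lg; have [hD _ _ h _] := seminorm_mu; have Lfg := hD _ _ Lf Lg; split => //.
have := h _ _ Lf Lg; rewrite (normH_nuH Lf).1 (normH_nuH Lg).1 (normH_nuH Lfg).1.
by rewrite -rmorphD lecR.
Qed.

Lemma nuH_Z (c : R[i]) f : inLH alpha beta mu f ->
  inLH alpha beta mu (fun t => c * f t) /\ nuH mu (fun t => c * f t) = cmod c * nuH mu f.
Proof.
move=> Lf; have [_ hZ _ _ h] := seminorm_mu; have Lcf := hZ c _ Lf; split => //.
have := h c _ Lf; rewrite (normH_nuH Lf).1 (normH_nuH Lcf).1 normcE_cmod.
by rewrite -rmorphM => /complexI.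
Qed.

End AnyMeasure.

Definition nu N f := nuH (mdiracs N) f.
Local Notation point0 := (fun=> point : nat).

Lemma nu_ge0 N f : 0 <= nu N f.
Proof.
by have [] := @normH_nuH (mdiracs N) (@sigma_finite_mdiracs R N) f
  (@inLH_mdiracs R k n alpha beta N f).
Qed.

Lemma nu_cint N f : isum N (enum {: Jt k n}) (fH alpha beta f) point0 = (nu N f `^ q)%:C.
Proof.
have [h _] := @cint_nuH (mdiracs N) (@sigma_finite_mdiracs R N) f
  (@inLH_mdiracs R k n alpha beta N f).
by rewrite -cint_mdiracs h.
Qed.

Lemma nu_D N f g : nu N (fun t => f t + g t) <= nu N f + nu N g.
Proof.
by have [] := @nuH_D (mdiracs N) (@sigma_finite_mdiracs R N) f g
  (@inLH_mdiracs R k n alpha beta N f)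
  (@inLH_mdiracs R k n alpha beta N g).
Qed.

Lemma nu_Z N (c : R[i]) f : nu N (fun t => c * f t) = cmod c * nu N f.
Proof.
by have [] := @nuH_Z (mdiracs N) (@sigma_finite_mdiracs R N) c f
  (@inLH_mdiracs R k n alpha beta N f).
Qed.

Opaque nu.

Lemma nu_sum N (m : nat) (f : 'I_m -> k.-tuple nat -> R[i]) :
  (forall i, nu N (f i) <= 1) -> nu N (fun t => \sum_i f i t) <= m%:R.
Proof.
elim: m f => [|m IH] f h.
  have -> : (fun t => \sum_i f i t) = (fun t => 0 * (fun=> 0) t).
    by apply: funext => t; rewrite big_ord0 mul0r.
  by rewrite nu_Z cmod0 mul0r.
have -> : (fun t => \sum_i f i t) = (fun t => f ord0 t + \sum_i f (lift ord0 i) t).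
  by apply: funext => t; rewrite big_ord_recl.
by apply: le_trans (nu_D _ _ _) _; rewrite -natr1 addrC lerD// IH.
Qed.

Lemma nu_le1 N f : (nu N f <= 1) = (nu N f `^ q <= 1).
Proof.
have E : 1 `^ q = 1 :> R by rewrite powR1.
apply/idP/idP => [h|]; first by rewrite -E; apply: ler_powRl; rewrite ?nu_ge0// ltW.
rewrite leNgt; apply: contraTT; rewrite -ltNge negbK => h.
by rewrite -E; apply: gt0_ltr_powR; rewrite ?nnegrE ?nu_ge0.
Qed.

Section TypeIHoelder.
Variable s : R.
Hypothesis hI : typeI alpha beta s.
Local Notation m := #|supp_set alpha beta|.
Local Notation e := (@edge R k n alpha beta).

Lemma form_nu_typeI N f :
  form e N (fun _ t => cmod (f t) `^ s) = nu N f `^ q.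
Proof.
apply: complexI; rewrite -nu_cint /form (isum_raddf (real_complex R)).
by apply: eq_isum => x; rewrite (fH_typeI hI).
Qed.

(** Hoelder's inequality by tensor powers. The triangle inequality for the sum of the functions F_i
    ^ (1 / s) bounds the form by m ^ q for every [N]; tensor squares then bound all its powers of
    order [2 ^ j] by the same constant. *)
Lemma form_typeI_le1 N (F : 'I_m -> k.-tuple nat -> R) :
  (forall i t, 0 <= F i t) -> (forall i, form e N (fun _ => F i) <= 1) -> form e N F <= 1.
Proof.
have [s1 _] := hI; have s0 : 0 < s by lra.
move=> F0 F1; apply: (@le1_of_pow_bounded _ _ (m%:R `^ q)); first exact: form_ge0.
move=> j; elim: j N F F0 F1 => [|j IH] N F F0 F1; last first.
  rewrite expnS exprM expr2 -form_tens; apply: IH => [i t|i]; first by rewrite mulr_ge0.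
  rewrite form_tens -[leRHS]mulr1 ler_pM// form_ge0//.
pose f i t : R[i] := (F i t `^ s^-1)%:C.
have cf i t : cmod (f i t) `^ s = F i t.
  by rewrite cmod_real ?powR_ge0// -powRrM mulVf ?gt_eqF// powRr1.
have f1 i : nu N (f i) <= 1.
  rewrite nu_le1 -form_nu_typeI; apply: le_trans (F1 i); rewrite le_eqVlt.
  by apply/orP; left; apply/eqP; apply: eq_form => _ t; rewrite cf.
have := nu_sum f1 => /(ler_powRl (ltW q_gt0) (nu_ge0 _ _)).
rewrite expr1; apply: le_trans; rewrite -form_nu_typeI; apply: ler_form => i t.
rewrite F0 -cf /=; apply: ler_powRl; [lra|exact: cmod_ge0|].
rewrite -(rmorph_sum (real_complex R)) !cmod_real ?sumr_ge0 ?powR_ge0// => [|l _];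
  last exact: powR_ge0.
(* Each nonnegative summand is at most the whole sum, so on every edge [F i] is dominated by the
   power [s] of that sum. *)
by rewrite (bigD1 i)//= lerDl sumr_ge0// => l _; exact: powR_ge0.
Qed.

Lemma form_typeI_comb N (F G : k.-tuple nat -> R) (p l : R) :
  (forall t, 0 <= F t) -> (forall t, 0 <= G t) -> 0 <= p -> 0 <= l -> p + l = 1 ->
  form e N (fun _ => F) <= 1 -> form e N (fun _ => G) <= 1 ->
  form e N (fun _ t => p * F t + l * G t) <= 1.
Proof.
move=> F0 G0 p0 l0 pl F1 G1; apply: le_trans (ler_norm _) _.
rewrite -[leRHS](expr1n _ m) -pl; apply: form_comb_le => // phi.
rewrite ger0_norm; first apply: form_typeI_le1 => [i t|i]; last apply: form_ge0 => i t;
  by rewrite /pick2; case: (phi i).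
Qed.

End TypeIHoelder.

Section TypeIIHoelder.
Hypothesis hII : typeII alpha beta.
Local Notation m := #|supp_set alpha beta|.
Local Notation e := (@edge R k n alpha beta).
Local Notation tw := (@twist R k n alpha beta).

Lemma form_nu_typeII N f : form e N (fun i t => tw i (f t)) = (nu N f ^+ m)%:C.
Proof.
rewrite -powR_mulrn ?nu_ge0// -(hsize_typeII hII) -nu_cint.
by apply: eq_isum => x; rewrite (fH_typeII hII).
Qed.

Lemma twistM i u v : tw i (u * v) = tw i u * tw i v.
Proof. by rewrite /twist; case: ifP => // _; rewrite rmorphM. Qed.

Lemma twistD i u v : tw i (u + v) = tw i u + tw i v.
Proof. by rewrite /twist; case: ifP => // _; rewrite rmorphD. Qed.

Lemma twistJ i u : tw i (Num.conj u) = Num.conj (tw i u).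
Proof. by rewrite /twist; case: ifP. Qed.

Lemma twist_sum i (I : finType) (u : I -> R[i]) : tw i (\sum_l u l) = \sum_l tw i (u l).
Proof. by rewrite /twist; case: ifP => // _; rewrite rmorph_sum. Qed.

Lemma twist_real i (r : R) u : tw i (r%:C * u) = r%:C * tw i u.
Proof. by rewrite twistM; congr (_ * _); rewrite /twist; case: ifP => // _; exact: conjc_real. Qed.

Lemma form_conj N (F : 'I_m -> k.-tuple nat -> R[i]) :
  form e N (fun i t => Num.conj (F i t)) = Num.conj (form e N F).
Proof.
rewrite /form [RHS](isum_raddf (Num.conj : {rmorphism R[i] -> R[i]})).
by apply: eq_isum => x; apply/esym; exact: rmorph_prod.
Qed.

Lemma nu_tens N f g : nu (N * N) (tens N f g) ^+ m = nu N f ^+ m * nu N g ^+ m.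
Proof.
apply: complexI; rewrite rmorphM /= -!form_nu_typeII -form_tens.
by apply: eq_form => i t; rewrite twistM.
Qed.

(** Conjugating [f] conjugates the form, and the form is real by [form_nu_typeII]. *)
Lemma nu_conj N f : nu N (fun t => Num.conj (f t)) ^+ m = nu N f ^+ m.
Proof.
apply: complexI; rewrite -!form_nu_typeII.
have -> : form e N (fun i t => tw i (f t)) = Num.conj (form e N (fun i t => tw i (f t))).
  by rewrite form_nu_typeII; apply/esym; exact: conjc_real.
by rewrite -form_conj; apply: eq_form => i t; rewrite twistJ.
Qed.

Hypothesis m0 : (0 < m)%N.

Lemma nu_le1_exp N f : (nu N f <= 1) = (nu N f ^+ m <= 1).
Proof. by rewrite -[in RHS](expr1n _ m) ler_pXn2r// ?nnegrE ?nu_ge0. Qed.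

(** The expansion of a sum now has complex terms, so a single one need not be bounded by the total.
    Replacing each [f i] by its tensor product with its conjugate turns every term into a squared
    modulus. *)
Lemma form_typeII_le1 N (f : 'I_m -> k.-tuple nat -> R[i]) :
  (forall i, nu N (f i) <= 1) -> `|form e N (fun i t => tw i (f i t))| <= 1.
Proof.
move=> f1; rewrite normcE_cmod (lecR _ 1).
set z := form e N _.
suff : cmod z ^+ 2 <= 1.
  by rewrite -[leRHS](expr1n _ 2) ler_pXn2r// ?nnegrE ?cmod_ge0.
apply: (@le1_of_pow_bounded _ _ (m%:R ^+ m)); first by rewrite sqr_ge0.
rewrite /z {z} => j; elim: j N f f1 => [|j IH] N f f1; last first.
  rewrite expnS exprM; have := IH (N * N)%N (fun i => tens N (f i) (f i)).
  rewrite -(eq_form e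
    (F := fun i => tens N (fun t => tw i (f i t)) (fun t => tw i (f i t)))); last first.
    by move=> i t; rewrite twistM.
  rewrite form_tens cmodM -expr2; apply => i; rewrite nu_le1_exp nu_tens.
  by rewrite -[leRHS]mulr1 ler_pM ?exprn_ge0 ?nu_ge0// -nu_le1_exp.
pose h i := tens N (f i) (fun t => Num.conj (f i t)).
have h1 i : nu (N * N) (h i) <= 1.
  rewrite nu_le1_exp nu_tens nu_conj.
  by rewrite -[leRHS]mulr1 ler_pM ?exprn_ge0 ?nu_ge0// -nu_le1_exp.
have hphi (phi : {ffun 'I_m -> 'I_m}) : form e (N * N) (fun i t => tw i (h (phi i) t)) =
    (cmod (form e N (fun i t => tw i (f (phi i) t))) ^+ 2)%:C.
  rewrite -mulcJ_cmod -form_conj -form_tens; apply: eq_form => i t.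
  by rewrite /h /tens twistM twistJ.
have := nu_sum h1; rewrite -(@ler_pXn2r _ m)// ?nnegrE ?nu_ge0//.
rewrite expr1; apply: le_trans.
rewrite -lecR -form_nu_typeII.
rewrite (eq_form e (F := fun i t => tw i (\sum_l h l t))
  (G := fun i t => \sum_l tw i (h l t))); last first.
  by move=> i t; rewrite twist_sum.
rewrite form_sum (eq_bigr _ (fun phi _ => hphi phi)) -(rmorph_sum (real_complex R)) lecR.
(* The identity choice gives the wanted form; the other terms are nonnegative and are dropped. *)
rewrite (bigD1 [ffun i => i])//=.
rewrite (eq_form e (F := fun i t => tw i (f ([ffun i => i] i) t))
  (G := fun i t => tw i (f i t))); last by move=> i t; rewrite ffunE.
by rewrite lerDl sumr_ge0// => phi _; exact: sqr_ge0.
Qed.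

End TypeIIHoelder.

End SemiNorming.

(** * Smoothness and convexity estimates uniform in [N] *)

Lemma powR_sum_le (R : realType) (q a b D : R) : 1 <= q -> 0 <= a -> 0 <= b -> 0 <= D ->
  a `^ q + b `^ q <= 2 * (1 + D) -> a + b <= 2 * (1 + D).
Proof.
move=> q1 a0 b0 D0 h.
(* Bernoulli at both points gives [q * (a + b - 2) <= 2 * D], and [1 <= q] removes the factor. *)
have := powR_convex_at1 q1 a0; have := powR_convex_at1 q1 b0 => h1 h2.
have hq : q * (a + b - 2) <= 2 * D by rewrite mulrBr mulrDr in h1 h2 *; lra.
have [ab|ab] := lerP (a + b) 2; first lra.
have : 1 * (a + b - 2) <= q * (a + b - 2) by apply: ler_wpM2r => //; lra.
lra.
Qed.

(** Checks the exponent condition of [prod_tradeoff]; in the application [s * u] is the size |H|. *)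
Lemma min1_half_bounds (R : realType) (s u : R) : 1 < s -> 1 <= u -> 2 <= s * u ->
  0 <= Num.min 1 (s / 2) /\ 1 <= Num.min 1 (s / 2) * u.
Proof. by move=> s1 u1 su; rewrite /Num.min; case: ifP => _; split; lra. Qed.

Lemma norm_div_double (R : realType) (s x a b : R) : 1 < s -> `|x| <= s * (a + b) ->
  `|x / (2 * s)| <= 2^-1 * a + 2^-1 * b.
Proof.
move=> s1 h; have s0 : 0 < 2 * s by lra.
rewrite normrM normfV (gtr0_norm s0) ler_pdivrMr//; lra.
Qed.

Section UniformEstimates.
Context {R : realType} {k : nat} {n : 'I_k -> nat} (alpha beta : Vt k n -> R).
Local Open Scope complex_scope.
Implicit Types f g : k.-tuple nat -> R[i].
Hypothesis sn : semi_norming alpha beta.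
Hypothesis hq : 2 <= hsize alpha beta.
Local Notation q := (hsize alpha beta).
Local Notation m := #|supp_set alpha beta|.
Local Notation e := (@edge R k n alpha beta).
Local Notation nu := (nu alpha beta).

Let q_ge1 : 1 <= q := le_trans (ler1n R 2) hq.
Let q_gt0 : 0 < q := lt_le_trans (ltr0n R 2) hq.

(** The constant is chosen before [N]. The norms are only required to be at most 1, so that rescaled
    functions qualify in the passage to the limit. *)
Definition smooth_estimate (t : R) := exists2 C : R, 0 <= C & forall N f g tau,
  nu N f <= 1 -> nu N g <= 1 -> 0 < tau <= 1 ->
  nu N (fun x => f x - tau%:C * g x) + nu N (fun x => f x + tau%:C * g x)
    <= 2 * (1 + C * tau `^ t).

Definition convex_estimate := exists2 c : R, 0 < c & forall N f g,
  nu N f <= 1 -> nu N g <= 1 ->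
  nu N (fun x => (2^-1)%:C * (f x + g x)) `^ q
    + c * nu N (fun x => (2^-1)%:C * (f x - g x)) `^ q <= 1.

Lemma supp_gt0 : (0 < m)%N.
Proof.
rewrite lt0n; apply/eqP => m0; move: q_gt0; rewrite hsize_edge big1 ?ltxx// => i _.
by have := ltn_ord i; rewrite {2}m0.
Qed.

Section TypeI.
Variable s : R.
Hypothesis hI : typeI alpha beta s.
Hypothesis s1 : 1 < s.

Let modS f (t : k.-tuple nat) : R := cmod (f t) `^ s.
Let half f g (t : k.-tuple nat) : R := 2^-1 * modS f t + 2^-1 * modS g t.

Let modS_ge0 f t : 0 <= modS f t.
Proof. exact: powR_ge0. Qed.

Let half_ge0 f g t : 0 <= half f g t.
Proof. by rewrite addr_ge0// mulr_ge0. Qed.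

Let form_modS N f : nu N f <= 1 -> form e N (fun _ => modS f) <= 1.
Proof. by move=> f1; rewrite (form_nu_typeI sn hq hI) -(nu_le1 sn hq). Qed.

Let form_half N f g : nu N f <= 1 -> nu N g <= 1 -> form e N (fun _ => half f g) <= 1.
Proof.
move=> f1 g1; apply: (form_typeI_comb sn hq hI) => //; last 2 first.
- exact: form_modS.
- exact: form_modS.
- by rewrite -div1r -splitr.
Qed.

Lemma typeI_convex_estimate : convex_estimate.
Proof.
have [c /andP[c0 c1] hc] := powR_convex_pointwise s1.
exists c => // N f g f1 g1.
have two : (2^-1)%:C + (2^-1)%:C = 1 :> R[i].
  by rewrite -(rmorphD (real_complex R)) -div1r -splitr.
(* In terms of the half-sum [u] and the half-difference [v], the quantity [B] of
   [powR_convex_pointwise] is the average of |f| ^ s and |g| ^ s, whose form is at most 1. *)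
set u := fun x => _ * (f x + g x); set v := fun x => _ * (f x - g x).
have fE x : f x = u x + v x by rewrite /u /v -[LHS]mul1r -two; ring.
have gE x : g x = u x - v x by rewrite /u /v -[LHS]mul1r -two; ring.
move: u v fE gE => u v fE gE.
rewrite -(form_nu_typeI sn hq hI N u) -(form_nu_typeI sn hq hI N v) -isumZ -isumD.
apply: le_trans (form_half f1 g1); apply: ler_isum => x.
have sm : 2 <= s * m%:R by rewrite -(hsize_typeI hI).
have m1 : 1 <= m%:R :> R by rewrite ler1n supp_gt0.
have [hk hkm] := min1_half_bounds s1 m1 sm.
have key i : exists r, [/\ 0 <= r <= 1,
    modS u (hproj (e i) x) <= (1 - c * r) * half f g (hproj (e i) x) &
    modS v (hproj (e i) x) <= r `^ Num.min 1 (s / 2) * half f g (hproj (e i) x)].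
  set t := hproj _ _.
  have := hc _ _ _ (cmod_ge0 (u t)) (cmod_ge0 (v t)) (cdot_le (u t) (v t)).
  rewrite /=; set B := _ / 2; suff -> : B = half f g t by [].
  rewrite /half /modS -(powRM_exp2 _ (cmod_ge0 (f t))) -(powRM_exp2 _ (cmod_ge0 (g t))).
  rewrite [in RHS]fE [in RHS]gE cmodD_sqr cmodB_sqr /B -mulrDr mulrC addrC.
  by congr (_ * (_ `^ _ + _ `^ _)); ring.
(* Picks a witness of [key] on each edge; since one exists, the default 0 is never returned as a
   fallback. *)
pose r i := xget 0 [set r | [/\ 0 <= r <= 1,
    modS u (hproj (e i) x) <= (1 - c * r) * half f g (hproj (e i) x) &
    modS v (hproj (e i) x) <= r `^ Num.min 1 (s / 2) * half f g (hproj (e i) x)]]%classic.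
apply: (@prod_tradeoff _ _ _ _ _ r c (Num.min 1 (s / 2))) => //.
- exact: supp_gt0.
- by rewrite c0.
- by move=> i; split => //; exact: modS_ge0.
- by move=> i; have [y hy] := key i; rewrite /r; case: xgetP => [z -> //|/(_ y)].
Qed.

(** Pointwise, the power [s] of |f + tau g| and |f - tau g| is at most [p * P + l * L] and
    [p * P - l * L], where all mixed forms in [P] and [L] are at most 1. The even expansion then
    gives [(p + l) ^+ m + (p - l) ^+ m]. *)
Lemma typeI_smooth_estimate t : 1 <= t <= 2 -> t <= s -> (t = s \/ t = 2) -> smooth_estimate t.
Proof.
move=> /andP[t1 t2] ts tE; have s1' := s1.
have s0 : 0 < s by lra.
have [C C0 hC] := powR_smooth_pointwise s1 t1 ts t2 tE.
have a0 : 0 <= 2 * C by lra.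
have b0 : 0 <= 2 * s by lra.
have t12 : 1 <= t <= 2 by rewrite t1.
have [D D0 hD] := powR_even_part m a0 b0 t12.
exists D => // N f g tau f1 g1 tau01.
have /andP[tau0 tau1] := tau01.
have T0 : 0 <= tau `^ t := powR_ge0 _ _.
(* The normalisation that makes [P] a convex combination of |f| ^ s and [W]; the factor 2 appears
   because [W] is the average of |f| ^ s and |g| ^ s. *)
set p := 1 + 2 * C * tau `^ t.
have p0 : 0 < p by rewrite ltr_wpDr// mulr_ge0.
(* The factor [2 * s] is taken out of the linear term so that the remaining [L] satisfies
   [|L| <= W]. *)
set l := 2 * s * tau.
have l0 : 0 <= l by rewrite /l mulr_ge0// ltW.
pose W := half f g.
pose P x : R := p^-1 * modS f x + (2 * C * tau `^ t) / p * W x.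
pose lam x : R := s * (cmod (f x) `^ s / cmod (f x) ^+ 2) * cdot (f x) (g x).
pose L x : R := lam x / (2 * s).
have ip0 : 0 <= p^-1 by rewrite invr_ge0 ltW.
have cp0 : 0 <= 2 * C * tau `^ t / p by rewrite mulr_ge0// mulr_ge0.
have P0 x : 0 <= P x.
  by rewrite /P addr_ge0//; apply: mulr_ge0 => //; exact: half_ge0.
have PF : form e N (fun _ => P) <= 1.
  apply: (form_typeI_comb sn hq hI) => //.
  - exact: half_ge0.
  - by rewrite -[X in X + _]mul1r -mulrDl mulfV ?gt_eqF.
  - exact: form_modS.
  - exact: form_half.
have LW x : `|L x| <= W x.
  apply: norm_div_double => //.
  exact: (powR_mix1 (ltW s1) (cmod_ge0 (f x)) (cmod_ge0 (g x)) (cdot_le _ _)).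
have hphi (phi : {ffun 'I_m -> bool}) : `|form e N (pick2 (fun _ => P) (fun _ => L) phi)| <= 1.
  apply: le_trans (ler_norm_form _ _ _) _.
  apply: (@le_trans _ _ (form e N (pick2 (fun _ => P) (fun _ => W) phi))).
    apply: ler_form => i x; rewrite normr_ge0 /pick2 /=.
    by case: (phi i); [exact: LW|rewrite ger0_norm].
  apply: (form_typeI_le1 sn hq hI) => [i x|i]; rewrite /pick2.
    by case: (phi i); [exact: half_ge0|exact: P0].
  by case: (phi i); [exact: form_half|exact: PF].
have pw x (sg : R) : sg = 1 \/ sg = -1 ->
    (cmod (f x) ^+ 2 + 2 * (tau * (sg * cdot (f x) (g x))) + (tau * cmod (g x)) ^+ 2) `^ (s / 2)
    <= p * P x + sg * (l * L x).
  move=> hsg.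
  have nsg : `|sg| = 1 by case: hsg => ->; rewrite ?normrN normr1.
  have hcd : `|sg * cdot (f x) (g x)| <= cmod (f x) * cmod (g x).
    by rewrite normrM nsg mul1r cdot_le.
  apply: le_trans (hC _ _ _ _ (cmod_ge0 (f x)) (cmod_ge0 (g x)) hcd tau01) _.
  rewrite /P /L /l /lam /W /half /modS le_eqVlt; apply/orP; left; apply/eqP.
  set K := _ / cmod (f x) ^+ 2; move: K => K.
  by field; rewrite !gt_eqF.
have up x : modS (fun x => f x + tau%:C * g x) x <= p * P x + l * L x.
  have := pw x 1 (or_introl erefl); rewrite !mul1r; apply: le_trans.
  rewrite /modS -(powRM_exp2 _ (cmod_ge0 _)) cmodD_sqr cmodM cmod_real ?(ltW tau0)//.
  rewrite le_eqVlt; apply/orP; left; apply/eqP; congr (_ `^ _).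
  by rewrite /cdot; case: (f x) (g x) => [? ?] [? ?] /=; ring.
have dn x : modS (fun x => f x - tau%:C * g x) x <= p * P x - l * L x.
  have := pw x (-1) (or_intror erefl); rewrite !mulN1r; apply: le_trans.
  rewrite /modS -(powRM_exp2 _ (cmod_ge0 _)) cmodB_sqr cmodM cmod_real ?(ltW tau0)//.
  rewrite le_eqVlt; apply/orP; left; apply/eqP; congr (_ `^ _).
  by rewrite /cdot; case: (f x) (g x) => [? ?] [? ?] /=; ring.
move: up dn; set fp := (fun x => f x + _); set fm := (fun x => f x - _).
move: fp fm => fp fm up dn.
apply: (powR_sum_le q_ge1); rewrite ?nu_ge0 ?mulr_ge0//.
rewrite -(form_nu_typeI sn hq hI N fm) -(form_nu_typeI sn hq hI N fp).
apply: le_trans (hD tau tau01).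
apply: (@le_trans _ _ (form e N (fun _ x => p * P x - l * L x) +
    form e N (fun _ x => p * P x + l * L x))).
  apply: lerD; apply: ler_form => i x; rewrite powR_ge0 /=; [exact: dn|exact: up].
rewrite addrC; apply: le_trans (ler_norm _) _.
exact: (form_even_le (ltW p0) l0 hphi).
Qed.

End TypeI.

Section TypeII.
Hypothesis hII : typeII alpha beta.
Local Notation tw := (@twist R k n alpha beta).

(** The even expansion with [f] as [P] and [g] as [L]; [twist] is additive and commutes with the
    real scalar [l]. *)
Lemma typeII_pair_bound N f g (l : R) : 0 <= l -> nu N f <= 1 -> nu N g <= 1 ->
  nu N (fun x => f x + l%:C * g x) ^+ m + nu N (fun x => f x - l%:C * g x) ^+ m
    <= (1 + l) ^+ m + (1 - l) ^+ m.
Proof.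
move=> l0 f1 g1.
have hphi (phi : {ffun 'I_m -> bool}) :
    `|form e N (pick2 (fun i t => tw i (f t)) (fun i t => tw i (g t)) phi)| <= 1.
  pose h i := if phi i then g else f.
  have := @form_typeII_le1 _ _ _ _ _ sn hq hII supp_gt0 N h.
  rewrite (eq_form e (F := fun i t => tw i (h i t))
    (G := pick2 (fun i t => tw i (f t)) (fun i t => tw i (g t)) phi)); last first.
    by move=> i t; rewrite /h /pick2; case: (phi i).
  by apply => i; rewrite /h; case: ifP.
have l0C : 0 <= l%:C :> R[i] by rewrite (lecR 0).
have := form_even_le ler01 l0C hphi.
rewrite -(eq_form e (F := fun i t => tw i (f t + l%:C * g t))); last first.
  by move=> i t; rewrite twistD twist_real mul1r.
rewrite -[X in `|_ + X|](eq_form e (F := fun i t => tw i (f t - l%:C * g t))); last first.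
  move=> i t; rewrite mul1r -mulNr -(rmorphN (real_complex R)).
  by rewrite twistD twist_real rmorphN mulNr.
rewrite !(form_nu_typeII sn hq hII) -(rmorphD (real_complex R)) => h.
rewrite -lecR; apply: le_trans (le_trans _ h) _.
  by rewrite normcE_cmod lecR cmod_real// addr_ge0// exprn_ge0 ?nu_ge0.
by rewrite (rmorphD (real_complex R)) !(rmorphXn (real_complex R)) rmorphD rmorphB.
Qed.

Lemma nu_powR_typeII N f : nu N f `^ q = nu N f ^+ m.
Proof. by rewrite -powR_mulrn ?nu_ge0// -(hsize_typeII hII). Qed.

Lemma typeII_smooth_estimate : smooth_estimate 2.
Proof.
have t12 : 1 <= (2 : R) <= 2 by rewrite lexx andbT ler1n.
have [D D0 hD] := powR_even_part m (lexx 0) ler01 t12.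
exists D => // N f g tau f1 g1 tau01.
have /andP[tau0 tau1] := tau01.
have := typeII_pair_bound (ltW tau0) f1 g1.
set fp := (fun x => f x + _); set fm := (fun x => f x - _); move: fp fm => fp fm h.
apply: (powR_sum_le q_ge1); rewrite ?nu_ge0 ?mulr_ge0 ?powR_ge0//.
rewrite !nu_powR_typeII addrC; apply: le_trans h _.
by have := hD tau tau01; rewrite mul0r mul1r addr0.
Qed.

Lemma typeII_convex_estimate : convex_estimate.
Proof.
exists 1 => // N f g f1 g1.
have m0 := supp_gt0.
have main (a b : k.-tuple nat -> R[i]) : nu N a ^+ m + nu N b ^+ m <= (1 + 1) ^+ m ->
    nu N (fun x => (2^-1)%:C * a x) `^ q + 1 * nu N (fun x => (2^-1)%:C * b x) `^ q <= 1.
  move=> h; rewrite mul1r !nu_powR_typeII (nu_Z sn N _ a) (nu_Z sn N _ b).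
  rewrite cmod_real ?invr_ge0// !exprMn -mulrDr exprVn mulrC.
  by rewrite ler_pdivrMr ?exprn_gt0// mul1r.
apply: (main (fun x => f x + g x) (fun x => f x - g x)).
(* At [l = 1] the term [(1 - l) ^+ m] vanishes, because [m] is positive; halving the functions
   cancels the remaining 2 ^ m. *)
have := typeII_pair_bound ler01 f1 g1; rewrite subrr expr0n gtn_eqF// addr0.
have -> : (fun x => f x + 1%:C * g x) = (fun x => f x + g x).
  by apply: funext => x; rewrite mul1r.
have -> // : (fun x => f x - 1%:C * g x) = (fun x => f x - g x).
by apply: funext => x; rewrite mul1r.
Qed.

End TypeII.

End UniformEstimates.

(** * Passage to the counting measure *)

Section Limits.
Context {R : realType}.
Local Open Scope complex_scope.
Local Open Scope classical_set_scope.

Lemma cvg_powR_root (u : nat -> R) (v q : R) : 0 < q -> (forall N, 0 <= u N) -> 0 <= v ->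
  u N `^ q @[N --> \oo] --> v `^ q -> u N @[N --> \oo] --> v.
Proof.
move=> q0 u0 v0 h; apply/cvgrPdist_lt => eps e0.
have lo : \forall N \near \oo, v - eps < u N.
  have [ve|ve] := lerP 0 (v - eps); last by apply: nearW => N; exact: lt_le_trans ve (u0 N).
  have hlt : (v - eps) `^ q < v `^ q.
    by apply: gt0_ltr_powR; rewrite ?nnegrE// ltrBlDr ltrDl.
  apply: filterS (cvgr_gt _ h _ hlt) => N.
  by apply: contraTT; rewrite -!leNgt => hu; apply: ler_powRl => //; exact: ltW.
have up : \forall N \near \oo, u N < v + eps.
  have hlt : v `^ q < (v + eps) `^ q.
    by apply: gt0_ltr_powR; rewrite ?nnegrE ?addr_ge0 ?(ltW e0)// ltrDl.
  apply: filterS (cvgr_lt _ h _ hlt) => N.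
  apply: contraTT; rewrite -!leNgt => hu; apply: ler_powRl => //; first exact: ltW.
  by rewrite addr_ge0// ltW.
apply: filterS2 lo up => N h1 h2.
by rewrite ltr_norml; apply/andP; split; lra.
Qed.

Lemma le_of_scaled (x y : R) : 0 <= y -> (forall d, 0 < d -> x <= (1 + d) * y) -> x <= y.
Proof.
move=> y0 h; rewrite leNgt; apply/negP => yx.
move: y0; rewrite le_eqVlt => /predU1P[y0|y0].
  by have := h 1 ltr01; rewrite -y0 mulr0; lra.
(* With this value [(1 + d) * y] is the midpoint of [x] and [y]. *)
have d0 : 0 < (x - y) / (2 * y) by rewrite divr_gt0 ?mulr_gt0 ?subr_gt0.
have := h _ d0.
have -> : (1 + (x - y) / (2 * y)) * y = (x + y) / 2 by field; rewrite gt_eqF.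
lra.
Qed.

Lemma powR_scaled_sum (r a b c q : R) : 0 <= r -> 0 <= a -> 0 <= b ->
  (r * a) `^ q + c * (r * b) `^ q = r `^ q * (a `^ q + c * b `^ q).
Proof. by move=> r0 a0 b0; rewrite !powRM//; ring. Qed.

(** For [tau <= 1] the finer estimate applies. For larger [tau] the triangle inequality suffices,
    since then tau <= tau ^ t. *)
Lemma unif_smooth_intro {X : Type} (S : set (X -> R[i])) (nrm : (X -> R[i]) -> R) (t C : R) :
  1 <= t -> 0 <= C ->
  (forall x y tau, S x -> S y -> nrm x = 1 -> nrm y = 1 -> 0 < tau ->
    nrm (fun z => x z - tau%:C * y z) + nrm (fun z => x z + tau%:C * y z)
      <= 2 * (1 + tau) /\
    (tau <= 1 -> nrm (fun z => x z - tau%:C * y z) + nrm (fun z => x z + tau%:C * y z)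
      <= 2 * (1 + C * tau `^ t))) ->
  unif_smooth S nrm t.
Proof.
move=> t1 C0 h; exists (1 + C); split; first lra.
move=> tau tau0; apply: ge_ereal_sup => _ [x [y [Sx Sy nx ny ->]]].
rewrite lee_fin powRM ?(ltW tau0)//; last lra.
have [h1 h2] := h x y tau Sx Sy nx ny tau0.
have C1 : 1 + C <= (1 + C) `^ t by apply: le1r_powR => //; lra.
have T0 : 0 <= tau `^ t := powR_ge0 _ _.
apply: (@le_trans _ _ ((1 + C) * tau `^ t)); last by rewrite ler_wpM2r.
have CT := mulr_ge0 C0 T0.
have [tau1|tau1] := lerP tau 1; first by have := h2 tau1; rewrite mulrDl; lra.
have tt : tau <= tau `^ t by apply: le1r_powR => //; exact: ltW.
by rewrite mulrDl; lra.
Qed.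

Lemma unif_convex_intro {X : Type} (S : set (X -> R[i])) (nrm : (X -> R[i]) -> R) (q c : R) :
  1 <= q -> 0 < c -> (forall x y, S x -> S y -> nrm x = 1 -> nrm y = 1 ->
    [/\ 0 <= nrm (fun z => (2^-1)%:C * (x z + y z)),
    nrm (fun z => (2^-1)%:C * (x z - y z)) = 2^-1 * nrm (fun z => x z - y z) &
    nrm (fun z => (2^-1)%:C * (x z + y z)) `^ q
      + c * nrm (fun z => (2^-1)%:C * (x z - y z)) `^ q <= 1]) ->
  unif_convex S nrm q.
Proof.
move=> q1 c0 h; have q0 : 0 < q by lra.
have cq : 0 < c / q by rewrite divr_gt0.
(* Chosen so that (eps / C) ^ q = eps ^ q * (c / q). The division by [q] comes from Bernoulli: 1 - u
   ^ q <= q * (1 - u). *)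
exists ((c / q) `^ (- q^-1)); split; first exact: powR_gt0.
move=> eps /andP[e0 e1]; apply: le_ereal_inf_tmp => _ [x [y [[Sx Sy] nx ny hxy ->]]].
have -> : (eps / (c / q) `^ (- q^-1)) `^ q = eps `^ q * (c / q).
  rewrite -powRN opprK (powRM _ e0) ?powR_ge0// -powRrM mulVf ?gt_eqF//.
  by rewrite powRr1// ltW.
rewrite lee_fin.
have [u0 vE huv] := h x y Sx Sy nx ny.
have he : eps `^ q <= nrm (fun z => (2^-1)%:C * (x z - y z)) `^ q.
  by apply: ler_powRl => //; [exact: ltW|rewrite vE; lra].
have hu := powR_convex_at1 q1 u0.
have hc := ler_wpM2l (ltW c0) he.
rewrite mulrA ler_pdivrMr// mulrC [leRHS]mulrC; lra.
Qed.

End Limits.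

Section Ell.
Context {R : realType} {k : nat} {n : 'I_k -> nat} (alpha beta : Vt k n -> R).
Local Open Scope complex_scope.
Local Open Scope classical_set_scope.
Implicit Types f g : k.-tuple nat -> R[i].
Hypothesis sn : semi_norming alpha beta.
Hypothesis hq : 2 <= hsize alpha beta.
Local Notation q := (hsize alpha beta).
Local Notation nu := (nu alpha beta).
Local Notation S := (ellH alpha beta).
Local Notation nrm := (ellH_norm alpha beta).

Let q_ge1 : 1 <= q := le_trans (ler1n R 2) hq.
Let q_gt0 : 0 < q := lt_le_trans (ltr0n R 2) hq.
Let scount := sigma_finite_counting R.

Lemma ellH_norm_ge0 f : S f -> 0 <= nrm f.
Proof. by move=> Sf; have [] := normH_nuH sn scount Sf. Qed.

Lemma ellH_normD f g : S f -> S g ->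
  S (fun x => f x + g x) /\ nrm (fun x => f x + g x) <= nrm f + nrm g.
Proof. by move=> Sf Sg; exact: (nuH_D sn scount Sf Sg). Qed.

Lemma ellH_normZ c f : S f -> S (fun x => c * f x) /\ nrm (fun x => c * f x) = cmod c * nrm f.
Proof. by move=> Sf; exact: (nuH_Z sn scount c Sf). Qed.

Lemma ellH_normB f g : S f -> S g ->
  S (fun x => f x - g x) /\ nrm (fun x => f x - g x) <= nrm f + nrm g.
Proof.
move=> Sf Sg; have [Sg' ng] := ellH_normZ (-1) Sg.
have := ellH_normD Sf Sg'; rewrite ng.
have -> : cmod (-1 : R[i]) = 1 by rewrite /cmod /= oppr0 expr0n addr0 sqrrN expr1n sqrtr1.
have -> : (fun x => f x + -1 * g x) = (fun x => f x - g x).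
  by apply: funext => x; rewrite mulN1r.
by rewrite mul1r.
Qed.

Opaque ellH_norm.

(** Dominated convergence of the real part of f^H, with majorant |f|^H, whose integral is finite by
    membership in [S]. *)
Lemma nu_cvg_powR f : S f -> nu N f `^ q @[N --> \oo] --> nrm f `^ q.
Proof.
move=> Sf; have [cE _] := cint_nuH sn hq scount Sf.
have -> : nrm f `^ q = rint (@counting nat R) (fun x => complex.Re (fH alpha beta f x)).
  exact: esym (congr1 (@complex.Re R) cE).
have -> : (fun N => nu N f `^ q) =
    (fun N => rint (mdiracs N) (fun x => complex.Re (fH alpha beta f x))).
  apply: funext => N.
  have := congr1 (@complex.Re R) (nu_cint sn hq N f).
  by rewrite Re_isum rint_mdiracs => ->.
have [_ foo] := Sf.
apply: rint_counting_cvg foo => x; rewrite fH_cmod /=.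
rewrite -[leRHS](ger0_norm (cmod_ge0 _)) -ler_sqr ?nnegrE// !real_normK ?num_real//.
by rewrite cmod_sqr lerDl sqr_ge0.
Qed.

Lemma nu_cvg f : S f -> nu N f @[N --> \oo] --> nrm f.
Proof.
move=> Sf; apply: (cvg_powR_root q_gt0) (nu_cvg_powR Sf) => [N|].
  exact: nu_ge0.
exact: ellH_norm_ge0.
Qed.

(** The truncated norms tend to 1 but need not be at most 1; dividing by [1 + d] makes the uniform
    estimates applicable eventually. *)
Lemma near_rescaled f d : S f -> nrm f = 1 -> 0 < d ->
  \forall N \near \oo, nu N (fun x => (1 + d)^-1%:C * f x) <= 1.
Proof.
move=> Sf f1 d0; have d1 : 0 < 1 + d := addr_gt0 ltr01 d0.
have lt1 : nrm f < 1 + d by rewrite f1 ltrDl.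
apply: filterS (cvgr_lt _ (nu_cvg Sf) _ lt1) => N h.
by rewrite (nu_Z sn) cmod_real ?invr_ge0 ?(ltW d1)// ler_pdivrMl// mulr1 ltW.
Qed.

Lemma ellH_unif_smooth t : 1 <= t -> smooth_estimate alpha beta t -> unif_smooth S nrm t.
Proof.
move=> t1 [C C0 hC]; apply: (unif_smooth_intro t1 C0) => f g tau Sf Sg f1 g1 tau0.
have [Sg' ng'] := ellH_normZ tau%:C Sg.
have [Sm nm] := ellH_normB Sf Sg'; have [Sp np] := ellH_normD Sf Sg'.
rewrite ng' f1 g1 mulr1 cmod_real ?(ltW tau0)// in nm np.
split=> [|tau1]; first by apply: le_trans (lerD nm np) _; rewrite mulr_natl mulr2n.
have T0 : 0 <= tau `^ t := powR_ge0 _ _.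
(* The slack [d] is fixed first, then [N] tends to infinity, and finally [d] tends to 0. *)
apply: le_of_scaled => [|d d0]; first by rewrite mulr_ge0// addr_ge0// mulr_ge0.
have d1 : 0 < 1 + d := addr_gt0 ltr01 d0.
have tau01 : 0 < tau <= 1 by rewrite tau0.
apply: cvgr_to_le (cvgD (nu_cvg Sm) (nu_cvg Sp)) _.
apply: filterS2 (near_rescaled Sf f1 d0) (near_rescaled Sg g1 d0) => N fN gN.
have := hC N _ _ tau fN gN tau01.
set c := ((1 + d)^-1)%:C.
have -> : (fun x => c * f x - tau%:C * (c * g x)) = (fun x => c * (f x - tau%:C * g x)).
  by apply: funext => x; ring.
have -> : (fun x => c * f x + tau%:C * (c * g x)) = (fun x => c * (f x + tau%:C * g x)).
  by apply: funext => x; ring.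
rewrite /= (nu_Z sn N c (fun x => f x - tau%:C * g x)) (nu_Z sn N c (fun x => f x + tau%:C * g x)).
by rewrite cmod_real ?invr_ge0 ?(ltW d1)// -mulrDr ler_pdivrMl.
Qed.

Lemma ellH_unif_convex : convex_estimate alpha beta -> unif_convex S nrm q.
Proof.
move=> [c c0 hc]; apply: (unif_convex_intro q_ge1 c0) => f g Sf Sg f1 g1.
have [Sd nd] := ellH_normB Sf Sg; have [Sa na] := ellH_normD Sf Sg.
have h0 : 0 <= 2^-1 :> R by rewrite invr_ge0.
have [Su nu'] := ellH_normZ (2^-1)%:C Sa; have [Sv nv] := ellH_normZ (2^-1)%:C Sd.
split; [exact: (ellH_norm_ge0 Su)|exact: etrans nv (congr1 (fun r => r * _) (cmod_real h0))|].
apply: le_of_scaled => // d' d'0; rewrite mulr1.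
(* The estimate is homogeneous of degree [q], so rescaling by [1 + d] costs (1 + d) ^ q, which this
   choice makes equal to [1 + d']. *)
pose d := (1 + d') `^ q^-1 - 1.
have d1 : 1 + d = (1 + d') `^ q^-1 by rewrite /d; ring.
have d0 : 0 < d.
  have E : 1 `^ q^-1 = 1 :> R by rewrite powR1.
  rewrite /d subr_gt0 -[ltLHS]E; apply: gt0_ltr_powR; rewrite ?invr_gt0 ?nnegrE// ?ltrDl//.
  by rewrite addr_ge0// ltW.
have dq : (1 + d) `^ q = 1 + d'.
  by rewrite d1 -powRrM mulVf ?gt_eqF// powRr1// addr_ge0// ltW.
have dp' : 0 < 1 + d' := addr_gt0 ltr01 d'0.
have dp : 0 < 1 + d := addr_gt0 ltr01 d0.
apply: cvgr_to_le (cvgD (nu_cvg_powR Su) (cvgMl_tmp (a := c) (nu_cvg_powR Sv))) _.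
apply: filterS2 (near_rescaled Sf f1 d0) (near_rescaled Sg g1 d0) => N fN gN.
have := hc N _ _ fN gN.
set b := ((1 + d)^-1)%:C; set a := (2^-1)%:C.
have -> : (fun x => a * (b * f x + b * g x)) = (fun x => b * (a * (f x + g x))).
  by apply: funext => x; ring.
have -> : (fun x => a * (b * f x - b * g x)) = (fun x => b * (a * (f x - g x))).
  by apply: funext => x; ring.
rewrite /= (nu_Z sn N b (fun x => a * (f x + g x))) (nu_Z sn N b (fun x => a * (f x - g x))).
have r0 : 0 <= (1 + d)^-1 by rewrite invr_ge0 ltW.
have rq : (1 + d)^-1 `^ q = (1 + d')^-1.
  by rewrite -powR_inv1 ?(ltW dp)// powRAC dq powR_inv1 ?(ltW dp').
rewrite (cmod_real r0) (powR_scaled_sum _ _ r0 (nu_ge0 sn N _) (nu_ge0 sn N _)) rq.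
by rewrite ler_pdivrMl ?mulr1.
Qed.

End Ell.


Theorem theorem3p8 (R : realType) (k : nat) (n : 'I_k -> nat)
    (alpha beta : {dffun forall i : 'I_k, 'I_(n i).+1} -> R) :
  semi_norming alpha beta ->
  non_factorizable alpha beta ->
  2 <= hsize alpha beta ->
  ((typeII alpha beta \/ (exists s : R, typeI alpha beta s /\ 2 <= s)) ->
     unif_smooth (ellH alpha beta) (ellH_norm alpha beta) 2 /\
     unif_convex (ellH alpha beta) (ellH_norm alpha beta) (hsize alpha beta)) /\
  (forall s : R, typeI alpha beta s -> 1 < s <= 2 ->
     unif_smooth (ellH alpha beta) (ellH_norm alpha beta) s /\
     unif_convex (ellH alpha beta) (ellH_norm alpha beta) (hsize alpha beta)).
Proof.
move=> sn _ hq; have two1 : 1 <= 2 :> R by rewrite ler1n.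
split=> [[hII|[s [hI s2]]]|s hI /andP[s1 s2]].
- split; first exact (ellH_unif_smooth sn hq two1 (typeII_smooth_estimate sn hq hII)).
  exact (ellH_unif_convex sn hq (typeII_convex_estimate sn hq hII)).
- have s1 : 1 < s by exact: lt_le_trans (ltr1n R 2) s2.
  have t12 : 1 <= (2 : R) <= 2 by rewrite two1 lexx.
  split; last exact (ellH_unif_convex sn hq (typeI_convex_estimate sn hq hI s1)).
  exact (ellH_unif_smooth sn hq two1 (typeI_smooth_estimate sn hq hI s1 t12 s2 (or_intror erefl))).
- have t12 : 1 <= s <= 2 by rewrite ltW.
  split; last exact (ellH_unif_convex sn hq (typeI_convex_estimate sn hq hI s1)).
  exact (ellH_unif_smooth sn hq (ltW s1)
    (typeI_smooth_estimate sn hq hI s1 t12 (lexx s) (or_introl erefl))).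
Qed.
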